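(* Let $\mathcal G$ and $\widetilde{\mathcal G}$ be two independent random graphs on the same metric space $(V,d_V)$, both satisfying the BK inequality. Let $\alpha,\beta\in(\frac d2,d)$ with $\alpha\le\beta$ and $2\alpha+2\beta>3d$, and suppose there exists $C>0$ such that for all $x,y\in V$, the probability that $x$ and $y$ are connected in $\mathcal G$ is at most $C\,g_\alpha(x,y)$, and the probability that $x$ and $y$ are connected in $\widetilde{\mathcal G}$ is at most $C\,g_\beta(x,y)$. Let $\mathcal C_0$ and $\widetilde{\mathcal C}_0$ be the clusters (connected components) of $0$ in $\mathcal G$ and $\widetilde{\mathcal G}$ respectively. There exists a constant $\kappa>0$ such that $$\mathbb E\Big[\exp\big(\kappa\cdot|\mathcal C_0\cap\widetilde{\mathcal C}_0|^\gamma\big)\Big]<\infty,\qquad\text{with }\ \gamma=\frac{2\alpha-d}{d+2\alpha-2\beta}.$$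
   Context: $(V,d_V)$ is a countable metric space, with balls $B(x,r)=\{y\in V: d_V(x,y)\le r\}$, of polynomial volume growth: there are a real $d\ge 1$ and constants $c_1,c_2>0$ with $c_1 r^d\le |B(x,r)|\le c_2 r^d$ for all $x\in V$, $r\ge 1$. A vertex $0\in V$ (the origin) is fixed arbitrarily. The random graphs have deterministic vertex set $V$ and possibly random edge sets. For $\alpha>0$, $g_\alpha(x,y)=\frac{1}{1+d_V(x,y)^\alpha}$. BK inequality for a random graph $\mathcal G$: an event $E$ is increasing if whenever $\{\mathcal G=A\}\subseteq E$ for a fixed graph $A$ with vertex set $V$, then $\{\mathcal G=B\}\subseteq E$ for every graph $B$ on $V$ containing $A$ as a subgraph. A finite graph $A$ witnesses $E$ if $\{A\subseteq\mathcal G\}\subseteq E$. For increasing events $E,F$, $E\circ F$ is the event that there exist two finite subgraphs of $\mathcal G$ with disjoint edge sets, one witnessing $E$ and the other witnessing $F$. $\mathcal G$ satisfies the BK inequality if $\mathbb P(E\circ F)\le \mathbb P(E)\,\mathbb P(F)$ for all increasing events $E,F$. *)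

(* Defs.v *)
From HB Require Import structures.
From mathcomp Require Import all_boot all_order all_algebra.
From mathcomp Require Import all_classical all_reals all_analysis.

Set Implicit Arguments.
Unset Strict Implicit.
Unset Printing Implicit Defensive.

Import Order.TTheory GRing.Theory Num.Theory.

Local Open Scope classical_set_scope.
Local Open Scope ring_scope.

Record sgraph (V : choiceType) := SGraph {
  adj :> rel V ;
  adj_sym : symmetric adj ;
  adj_irr : irreflexive adj }.

Definition empty_sgraph (V : choiceType) : sgraph V :=
  @SGraph V (fun _ _ => false) (fun _ _ => erefl) (fun _ => erefl).

HB.instance Definition _ (V : choiceType) := gen_eqMixin (sgraph V).
HB.instance Definition _ (V : choiceType) := gen_choiceMixin (sgraph V).
HB.instance Definition _ (V : choiceType) :=
  isPointed.Build (sgraph V) (empty_sgraph V).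

Definition edge_events (V : choiceType) : set (set (sgraph V)) :=
  [set E | exists x y : V, E = [set g : sgraph V | g x y]].

(* The sigma-algebra on graphs generated by the presence of single edges: a
   random graph is a measurable map into [sgraph V], i.e. a map G for which
   every {w | x ~ y in G w} is an event. *)
HB.instance Definition _ (V : choiceType) :=
  Measurable.copy (sgraph V) (g_sigma_algebraType (@edge_events V)).

Section graphs.
Context {V : choiceType}.
Implicit Types (g A B : sgraph V) (E F : set (sgraph V)).

Definition subgraph A B := forall x y, A x y -> B x y.

(* The vertex set is always V, so only the edge set is required to be finite. *)
Definition finite_sgraph A := finite_set [set e : V * V | A e.1 e.2].

Definition edge_disjoint A B := forall x y, ~ (A x y /\ B x y).

Definition connected_in g (x y : V) :=
  exists p : seq V, path g x p /\ last x p = y.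

Definition graph_cluster g (x : V) : set V := [set y | connected_in g x y].

(* Events of a random graph G are the preimages G @^-1` E of measurable sets E
   of graphs; monotonicity, witnesses and disjoint occurrence are properties
   of E. *)
Definition increasing_event E := forall A B, subgraph A B -> E A -> E B.

Definition witnesses A E := [set g | subgraph A g] `<=` E.

Definition disjoint_occurrence E F : set (sgraph V) :=
  [set g | exists A B, [/\ finite_sgraph A /\ finite_sgraph B,
    subgraph A g /\ subgraph B g, edge_disjoint A B,
    witnesses A E & witnesses B F]].

End graphs.

Definition BK_inequality (R : realType) (V : choiceType) (disp : measure_display)
    (Omega : measurableType disp) (P : probability Omega R)
    (G : {RV P >-> sgraph V}) :=
  forall E F : set (sgraph V), measurable E -> measurable F ->
    increasing_event E -> increasing_event F ->
    (P (G @^-1` disjoint_occurrence E F)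
      <= P (G @^-1` E) * P (G @^-1` F))%E.

Definition independent_graphs (R : realType) (V : choiceType)
    (disp : measure_display) (Omega : measurableType disp)
    (P : probability Omega R) (G1 G2 : {RV P >-> sgraph V}) :=
  forall E F : set (sgraph V), measurable E -> measurable F ->
    (P (G1 @^-1` E `&` G2 @^-1` F) = P (G1 @^-1` E) * P (G2 @^-1` F))%E.

(* The library's [closed_ball] is the closure of the open ball, which can be
   strictly smaller than {y | d(x, y) <= r} (e.g. in a discrete space). *)
Definition mball (R : realType) (V : metricType R) (x : V) (r : R) : set V :=
  [set y | mdist x y <= r].

Definition polynomial_growth (R : realType) (V : metricType R) (d : R) :=
  exists c1 c2 : R, [/\ 0 < c1, 0 < c2 &
    forall (x : V) (r : R), 1 <= r ->
      ((c1 * r `^ d)%:E <= counting (mball x r))%E /\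
      (counting (mball x r) <= (c2 * r `^ d)%:E)%E].

Definition gker (R : realType) (V : metricType R) (a : R) (x y : V) : R :=
  (1 + mdist x y `^ a)^-1.

(* Main.v *)
Require Import Defs.
From mathcomp Require Import all_boot all_order all_algebra.
From mathcomp Require Import all_classical all_reals all_analysis.
From mathcomp Require Import measurable_realfun lra zify.

(** Distances are read on a dyadic scale: the level of a pair x, y is the least
    i with d(x, y) <= 2^i.  Levels satisfy the triangle inequality of an
    ultrametric up to one unit, a ball of level i has O(D^i) points with
    D = 2^d, and with a = 2^-alpha, b = 2^-beta the hypotheses on the connection
    probabilities become P(x <-> y) <= C a^level(x, y), and the same with b for
    the second graph.  All kernel estimates are then geometric sums in the
    ratios q = a^2 D < 1 and q' = b^2 D < 1.

    One graph.  If finitely many pairs (the skeleton) are joined by edge-disjoint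
    trails and a further vertex y is connected to the skeleton, then the first
    vertex z at which a path from y meets one of the trails cuts that trail in
    two, and the skeleton grows by two pairs (disjoint_links_attach).  The BK
    inequality bounds the probability of each skeleton by the product of its
    connection probabilities (prob_disjoint_links).  Attaching k vertices of a
    finite set Lam one after the other gives the tree-graph bound
    E |C_0 n Lam|^k <= C k! (const Phi)^k with Phi the supremum over x of the sum
    of q^level(x, y) for y in Lam (links_moment_le), because
    sum_z a^level(x,z) a^level(z,y) a^level(v,z) is at most a constant times
    a^level(x,y) (q^level(x,v) + q^level(y,v)) (kernel_triple_sum).  Hence
    |C_0 n Lam| has an exponential tail on the scale Phi (cluster_tail).

    Two graphs.  Fix a scale r and let N be a small multiple of q^-r.  Up to
    probability exponentially small in N the following hold.
    - The two clusters do not meet outside the ball of level N: the expected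
      number of such points is a convergent geometric sum in abD < 1
      (far_intersection).
    - Every ball B of level i centred in that ball contains at most
      const q^-r (qD)^i points of the first cluster; for B the quantity Phi is
      of order (qD)^i (local_volume_tail).  Using the trivial bound D^i for
      i < r instead, the trace Lam of the first cluster satisfies
      sum_(y in Lam) q'^level(x, y) <= const (q'D)^r at every x: the two bounds
      agree at i = r, and q q' D < 1, which is 3d < 2 alpha + 2 beta, makes the
      scales i > r negligible (sparse_kernel_sum).
    - For each of the finitely many such Lam, by independence, the second
      cluster has at most const q^-r (q'D)^r points in Lam
      (dense_intersection).
    Thus |C_0 n C~_0| <= A M^r with M = q'D / q, outside an event of probability
    exponentially small in q^-r (intersection_tail).  Since
    M = 2^(d + 2 alpha - 2 beta) and 1/q = 2^(2 alpha - d), one has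
    M^gamma = 1/q for the stated gamma, and summing over r gives the exponential
    moment (stretched_exponential_moment). *)

Import Order.TTheory GRing.Theory Num.Theory.
Local Open Scope classical_set_scope.
Local Open Scope ring_scope.

Set Implicit Arguments.
Unset Strict Implicit.
Unset Printing Implicit Defensive.


(** * Skeletons of edge-disjoint trails *)

Section trails.
Context {V : choiceType}.
Implicit Types (g A B : sgraph V) (x y z : V) (p : seq V) (t : V * seq V).

(** Every edge is listed in both orientations, so that [uniq] of a
    concatenation of such lists says that the trails share no edge, while staying
    invariant under permuting, reversing and cutting trails. *)
Fixpoint trail_edges x p : seq (V * V) :=
  if p is y :: p' then (x, y) :: (y, x) :: trail_edges y p' else [::].

Definition trail_ends t := (t.1, last t.1 t.2).

Definition trails_edges (K : seq (V * seq V)) :=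
  flatten [seq trail_edges t.1 t.2 | t <- K].

Definition disjoint_links (L : seq (V * V)) : set (sgraph V) :=
  [set g | exists K : seq (V * seq V),
    [/\ L = map trail_ends K, all (fun t => path g t.1 t.2) K &
        uniq (trails_edges K)]].

Lemma trail_edges_cat x p1 p2 :
  trail_edges x (p1 ++ p2) = trail_edges x p1 ++ trail_edges (last x p1) p2.
Proof. by elim: p1 x => //= y p1 IH x; rewrite IH. Qed.

Lemma trail_edges_verts x p u v :
  (u, v) \in trail_edges x p -> (u \in x :: p) && (v \in x :: p).
Proof.
elim: p x => //= y p IH x; rewrite !inE => /or3P[/eqP[-> ->]|/eqP[-> ->]|/IH].
- by rewrite !eqxx !orbT.
- by rewrite !eqxx !orbT.
- by rewrite !inE => /andP[-> ->]; rewrite !orbT.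
Qed.

Lemma trail_edges_sym x p u v :
  ((u, v) \in trail_edges x p) = ((v, u) \in trail_edges x p).
Proof.
elim: p x => //= y p IH x; rewrite !inE IH !xpair_eqE.
by rewrite orbCA (andbC (u == y)) (andbC (u == x)).
Qed.

Lemma path_trail_edges g x p u v :
  path g x p -> (u, v) \in trail_edges x p -> g u v.
Proof.
elim: p x => //= y p IH x /andP[gxy gp]; rewrite !inE.
case/or3P => [/eqP[-> ->]|/eqP[-> ->]|/IH]//; last exact.
by rewrite adj_sym.
Qed.

Lemma uniq_trail_edges x p : uniq (x :: p) -> uniq (trail_edges x p).
Proof.
elim: p x => //= y p IH x /andP[]; rewrite inE negb_or => /andP[xy xp] yp.
rewrite IH //= inE negb_or xpair_eqE negb_and xy /= andbT; apply/andP; split.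
  by apply/negP => /trail_edges_verts; rewrite inE (negbTE xy) (negbTE xp).
by apply/negP => /trail_edges_verts; rewrite !inE (negbTE xy) (negbTE xp) andbF.
Qed.

Lemma connected_inC g x y : connected_in g x y -> connected_in g y x.
Proof.
case=> p [gp <-]; exists (rev (belast x p)); split; last first.
  by case: p gp => //= z p _; rewrite rev_cons last_rcons.
by rewrite rev_path (eq_path (e' := g))// => u v; rewrite adj_sym.
Qed.

(** The inclusion [q <= p] keeps the stopped path simple along the induction. *)
Lemma path_first_entrance g y p (S : {pred V}) :
    path g y p -> uniq (y :: p) -> last y p \in S ->
  exists q, [/\ path g y q, uniq (y :: q), last y q \in S,
    {in belast y q, forall u, u \notin S} & {subset q <= p}].
Proof.
elim: p y => [|v p IH] y /=; first by exists [::].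
move=> /andP[gyv gp] /andP[yvp up] lastS.
have [yS|yS] := boolP (y \in S); first by exists [::]; split.
have [q [gq uq lq bq qp]] := IH _ gp up lastS.
exists (v :: q); split => //=; first by rewrite gyv.
- apply/andP; split=> //; apply: contra yvp; rewrite !inE.
  by case/orP=> [->//|/qp ->]; rewrite orbT.
- by move=> u; rewrite inE => /orP[/eqP ->//|/bq].
- by move=> u; rewrite !inE => /orP[/eqP ->|/qp ->]; rewrite ?eqxx ?orbT.
Qed.

Lemma trail_edges_belast x p u v : (u, v) \in trail_edges x p ->
  (u \in belast x p) || (v \in belast x p).
Proof.
elim: p x => //= y p IH x; rewrite !inE => /or3P[/eqP[-> _]|/eqP[_ ->]|/IH].
- by rewrite eqxx.
- by rewrite eqxx orbT.
- by case/orP=> ->; rewrite !orbT.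
Qed.

(** The growth step of the tree-graph bound.  A simple path from [y] is followed
    up to the first vertex [z] of one of the trails.  Its edges have an endpoint
    before [z], hence off the trails, so they are new; and the trail through [z]
    is cut there into two trails that remain edge-disjoint. *)
Lemma disjoint_links_attach g (L : seq (V * V)) y e0 : disjoint_links L g ->
    e0 \in L -> connected_in g e0.1 y ->
  exists i : 'I_(size L), exists z, disjoint_links
    [:: ((nth e0 L i).1, z), (z, (nth e0 L i).2), (y, z) &
        take i L ++ drop i.+1 L] g.
Proof.
move=> [K [LK gK uK]] e0L /connected_inC[p [gp lp]].
pose S : {pred V} := mem (flatten [seq t.1 :: t.2 | t <- K]).
have lpS : last y p \in S.
  rewrite lp; move: e0L; rewrite LK => /mapP[t tK ->].
  by apply/flatten_mapP; exists t => //=; rewrite inE eqxx.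
move: lpS; case/shortenP: gp lp => {}p gp up _ _ lpS.
have [q [gq uq lq bq _]] := path_first_entrance gp up lpS.
case/flatten_mapP: (lq) => t tK zt.
have [i [iK KE nthi]] : exists i, [/\ (i < size K)%N,
    K = take i K ++ t :: drop i.+1 K & nth t K i = t].
  have iK : (index t K < size K)%N by rewrite index_mem.
  exists (index t K); split; rewrite ?nth_index//.
  by rewrite -{1}(cat_take_drop (index t K) K) (drop_nth t)// nth_index.
have iL : (i < size L)%N by rewrite LK size_map.
exists (Ordinal iL); exists (last y q) => /=.
have -> : nth e0 L i = trail_ends t by rewrite LK (nth_map t)// nthi.
case: t zt tK {iL} iK KE nthi => x s /= zt tK iK KE _.
move/splitPl: zt KE tK => [s1 s2 s1z] KE tK.
set z := last y q in lq s1z *.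
set K1 := take i K in KE *; set K2 := drop i.+1 K in KE *.
have bqE u v : (u, v) \in trail_edges y q -> (u, v) \notin trails_edges K.
  move=> uvq; apply/negP => /flatten_mapP[t' t'K uvt'].
  have /andP[ut vt] := trail_edges_verts uvt'.
  have uS : u \in S by apply/flatten_mapP; exists t'.
  have vS : v \in S by apply/flatten_mapP; exists t'.
  by case/orP: (trail_edges_belast uvq) => /bq/negP[].
exists [:: (x, s1), (z, s2), (y, q) & K1 ++ K2]; split => /=.
- rewrite /trail_ends /= s1z last_cat s1z map_cat.
  by rewrite map_take map_drop LK.
- move: gK; rewrite KE !all_cat /= cat_path s1z.
  by case/and3P => -> /andP[-> ->] ->; rewrite gq.
- rewrite /trails_edges /= map_cat flatten_cat.
  have pE : perm_eq (trails_edges K) (trail_edges x s1 ++ trail_edges z s2 ++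
      (flatten [seq trail_edges t.1 t.2 | t <- K1] ++
       flatten [seq trail_edges t.1 t.2 | t <- K2])).
    rewrite /trails_edges KE map_cat flatten_cat /= trail_edges_cat s1z.
    by rewrite perm_catCA -catA !perm_cat2l.
  rewrite catA.
  have -> : uniq ((trail_edges x s1 ++ trail_edges z s2) ++ trail_edges y q ++
      flatten [seq trail_edges t.1 t.2 | t <- K1] ++
      flatten [seq trail_edges t.1 t.2 | t <- K2]) =
      uniq (trail_edges y q ++ trails_edges K).
    by apply: perm_uniq; rewrite perm_catCA perm_cat2l perm_sym (perm_trans pE)// catA.
  rewrite cat_uniq uniq_trail_edges// uK andbT /=.
  by apply/hasPn => -[u v] uvK; apply: contraL uvK; exact: bqE.
Qed.

Lemma disjoint_links_loop g x : disjoint_links [:: (x, x)] g.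
Proof. by exists [:: (x, [::])]. Qed.

Definition edge_graph (E : seq (V * V)) : sgraph V :=
  @SGraph V (fun x y => (x != y) && (((x, y) \in E) || ((y, x) \in E)))
    (fun x y => congr2 andb (f_equal negb (eq_sym x y)) (orbC _ _))
    (fun x => congr2 andb (f_equal negb (eqxx x)) erefl).

Lemma edge_graph_sub g E :
  (forall u v, (u, v) \in E -> g u v) -> subgraph (edge_graph E) g.
Proof. by move=> gE x y /andP[_ /orP[/gE//|/gE]]; rewrite adj_sym. Qed.

Lemma edge_graph_finite E : finite_sgraph (edge_graph E).
Proof.
apply: (@sub_finite_set _ _ [set` E ++ [seq (e.2, e.1) | e <- E]]); last first.
  exact: finite_seq.
move=> -[x y] /= /andP[_ /orP[xyE|yxE]]; rewrite mem_cat ?xyE//.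
by apply/orP; right; apply/mapP; exists (y, x).
Qed.

Lemma path_edge_graph g E x p :
  path g x p -> {subset trail_edges x p <= E} -> path (edge_graph E) x p.
Proof.
elim: p x => //= y p IH x /andP[gxy gp] sE; rewrite IH// ?andbT; last first.
  by move=> e ep; apply: sE; rewrite !inE ep !orbT.
rewrite sE ?inE ?eqxx// andbT.
by apply: contraTneq gxy => ->; rewrite adj_irr.
Qed.

Lemma subgraph_path A g x p : subgraph A g -> path A x p -> path g x p.
Proof. by move=> Ag; apply: sub_path. Qed.

Lemma subgraph_connected A g x y :
  subgraph A g -> connected_in A x y -> connected_in g x y.
Proof. by move=> Ag [p [Ap <-]]; exists p; split=> //; exact: subgraph_path Ap. Qed.

Lemma increasing_connected x y : increasing_event [set g | connected_in g x y].
Proof. by move=> A B AB; exact: subgraph_connected. Qed.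

Lemma increasing_disjoint_links L : increasing_event (disjoint_links L).
Proof.
move=> A B AB [K [-> AK uK]]; exists K; split=> //.
by apply/allP => t tK; apply: subgraph_path AB _; move/allP: AK; exact.
Qed.

(** This turns skeletons into iterated disjoint occurrences, to which the BK
    inequality applies.  The equality, and not just an inclusion, makes the
    disjoint occurrence on the right measurable. *)
Lemma disjoint_links_cons e L : disjoint_links (e :: L) =
  disjoint_occurrence [set g | connected_in g e.1 e.2] (disjoint_links L).
Proof.
apply/seteqP; split => [g [[|t K] [eLK gK uK]]|g]; first by [].
  case: eLK gK uK => -> -> /= /andP[gt gK].
  rewrite /trails_edges /= cat_uniq => /and3P[ut tK uK].
  exists (edge_graph (trail_edges t.1 t.2)), (edge_graph (trails_edges K)).
  have gtK u v : (u, v) \in trails_edges K -> g u v.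
    by case/flatten_mapP => s sK; apply: path_trail_edges; move/allP: gK; exact.
  split.
  - by split; exact: edge_graph_finite.
  - by split; apply: edge_graph_sub => u v; [exact: path_trail_edges|exact: gtK].
  - move=> x y [/andP[_ xyt] /andP[_ xyK]].
    move: xyt; rewrite trail_edges_sym orbb => yxt.
    have xyt := yxt; rewrite trail_edges_sym in xyt.
    by move/hasPn: tK => tK; case/orP: xyK => /tK; rewrite ?yxt ?xyt.
  - move=> h /= /subgraph_connected; apply; exists t.2; split=> //.
    exact: path_edge_graph gt _.
  - move=> h /= /increasing_disjoint_links; apply; exists K; split=> //.
    apply/allP => s sK; apply: (@path_edge_graph g); first by move/allP: gK; exact.
    by move=> e0 e0s; apply/flatten_mapP; exists s.
move=> [A [B [_ [Ag Bg] AB wA wB]]].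
have [p [Ap lp]] : connected_in A e.1 e.2 by exact: wA.
have [K [LK BK uK]] : disjoint_links L B by exact: wB.
move: lp; case/shortenP: Ap => {}p Ap up _ lp.
exists ((e.1, p) :: K); split => /=.
- by rewrite /trail_ends /= lp LK; case: (e).
- rewrite (subgraph_path Ag Ap); apply/allP => t tK.
  by apply: subgraph_path Bg _; move/allP: BK; exact.
- rewrite /trails_edges /= cat_uniq uniq_trail_edges// uK andbT.
  apply/hasPn => -[u v] /flatten_mapP[t tK uvt]; apply/negP => uvp.
  apply: (AB u v); split; first exact: path_trail_edges uvp.
  by apply: path_trail_edges uvt; move/allP: BK; exact.
Qed.

End trails.

(** * Sums over a countable vertex set *)

Section countable_sums.
Context {V : choiceType}.

(** A partial enumeration, so that finite and infinite vertex sets are treated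
    alike. *)
Lemma countable_enumeration : countable [set: V] ->
  exists dec : nat -> option V, (forall z, exists n, dec n = Some z) /\
    (forall n m z, dec n = Some z -> dec m = Some z -> n = m).
Proof.
move=> /countable_injP[f finj].
have fI : injective f by move=> x y; apply: finj; rewrite inE.
exists (fun n => if pselect (exists z, f z = n) is left h then Some (projT1 (cid h))
  else None); split.
  move=> z; exists (f z); case: pselect => [h|]; last by case; exists z.
  by congr Some; apply: fI; case: cid.
move=> n m z; case: pselect => // h [<-]; case: pselect => // k [].
by case: cid => x fx; case: cid => y fy /= yx; rewrite -fx -fy yx.
Qed.

Context {R : realType} (dec : nat -> option V).
Hypothesis dec_surj : forall z, exists n, dec n = Some z.
Hypothesis dec_inj : forall n m z, dec n = Some z -> dec m = Some z -> n = m.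

Definition enum_term (f : V -> \bar R) (n : nat) : \bar R := oapp f 0%E (dec n).

Lemma enum_term_ge0 f n : (forall z, 0 <= f z)%E -> (0 <= enum_term f n)%E.
Proof. by move=> f0; rewrite /enum_term; case: (dec n) => /=. Qed.

Lemma uniq_pmap_dec N : uniq (pmap dec (iota 0 N)).
Proof.
suff : forall s, uniq s -> uniq (pmap dec s) by apply; exact: iota_uniq.
elim=> //= n s IH /andP[ns us]; case nz : (dec n) => [z|] /=; last exact: IH.
rewrite IH// andbT; apply/negP; rewrite mem_pmap => /mapP[m ms /esym mz].
by move: ns; rewrite (dec_inj nz mz) ms.
Qed.

Lemma sum_enum_term f N : (\sum_(0 <= n < N) enum_term f n =
  \sum_(z <- pmap dec (iota 0 N)) f z)%E.
Proof.
rewrite /index_iota subn0; elim: (iota 0 N) => [|n s IH] /=; first by rewrite !big_nil.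
rewrite big_cons IH /enum_term; case: (dec n) => [z|] /=; last by rewrite add0e.
by rewrite big_cons.
Qed.

Lemma enum_series_le (f : V -> R) (M : R) : (forall z, 0 <= f z) ->
  (forall Z : seq V, uniq Z -> \sum_(z <- Z) f z <= M) ->
  (\sum_(n <oo) enum_term (fun z => (f z)%:E) n <= M%:E)%E.
Proof.
move=> f0 fM; apply: lime_le.
  by apply: is_cvg_nneseries => n _ _; apply: enum_term_ge0 => z; rewrite lee_fin.
apply: nearW => N; rewrite sum_enum_term sumEFin lee_fin.
by apply: fM; exact: uniq_pmap_dec.
Qed.

Lemma enum_series_ge (f : V -> \bar R) z : (forall z, 0 <= f z)%E ->
  (f z <= \sum_(n <oo) enum_term f n)%E.
Proof.
move=> f0; have [n nz] := dec_surj z.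
apply: (@le_trans _ _ (\sum_(0 <= i < n.+1) enum_term f i)%E).
  rewrite big_nat_recr//= {2}/enum_term nz /= leeDr//.
  by apply: sume_ge0 => i _; exact: enum_term_ge0.
by apply: nneseries_lim_ge => m _ _; exact: enum_term_ge0.
Qed.

End countable_sums.

(** The integral of an arbitrary nonnegative function is the supremum over the
    simple functions below it, hence monotone. *)
Lemma le_integral_nneg d (T : measurableType d) (R : realType)
    (mu : {measure set T -> \bar R}) (f g : T -> \bar R) :
  (forall x, 0 <= f x)%E -> (forall x, f x <= g x)%E ->
  (\int[mu]_x f x <= \int[mu]_x g x)%E.
Proof.
move=> f0 fg; have g0 x : (0 <= g x)%E by exact: le_trans (fg x).
rewrite !ge0_integralTE//; apply: le_ereal_sup => _ [h hf <-].
by exists h => // x; exact: le_trans (fg x).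
Qed.

(** * Measurability of connection events *)

Section graph_measurability.
Context {V : choiceType} (countV : countable [set: V]).

Lemma countable_trails : countable [set: seq (V * seq V)].
Proof.
case/countable_injP: countV => f finj.
have fI : injective f by move=> x y; apply: finj; rewrite inE.
apply/countable_injP.
exists (fun K : seq (V * seq V) => pickle [seq (f t.1, map f t.2) | t <- K]).
move=> K K' _ _ /(pcan_inj pickleK); apply: inj_map => -[x p] [y q] /= [].
by move=> /fI -> /(inj_map fI) ->.
Qed.

Lemma countable_seq : countable [set: seq V].
Proof.
case/countable_injP: countV => f finj.
have fI : injective f by move=> x y; apply: finj; rewrite inE.
apply/countable_injP; exists (fun p => pickle (map f p)).
by move=> K K' _ _ /(pcan_inj pickleK); exact: inj_map.
Qed.

Lemma measurable_edge (x y : V) : measurable [set g : sgraph V | g x y].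
Proof. by apply: sub_sigma_algebra; exists x, y. Qed.

Lemma measurable_path (x : V) p : measurable [set g : sgraph V | path g x p].
Proof.
elim: p x => [|y p IH] x /=; first by rewrite (_ : [set _ | _] = setT)//; apply/seteqP.
rewrite [X in measurable X](_ : _ = [set g : sgraph V | g x y] `&` [set g : sgraph V | path g y p]).
  by apply: measurableI; [exact: measurable_edge|exact: IH].
by apply/seteqP; split => [g /andP[]//|g [/= -> ->]].
Qed.

Lemma measurable_connected (x y : V) : measurable [set g : sgraph V | connected_in g x y].
Proof.
rewrite [X in measurable X](_ : _ =
    \bigcup_p ([set g : sgraph V | path g x p] `&` [set _ | last x p = y])).
  apply: countable_bigcupT_measurable => [|p]; first exact: countable_seq.
  apply: measurableI; first exact: measurable_path.
  have [->|ne] := eqVneq (last x p) y.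
    by rewrite (_ : [set _ | _] = setT)//; apply/seteqP.
  by rewrite (_ : [set _ | _] = set0)//; apply/seteqP; split=> // g /= e; rewrite e eqxx in ne.
apply/seteqP; split => [g [p [gp lp]]|g [p _ [gp lp]]]; last by exists p.
by exists p.
Qed.

Lemma measurable_disjoint_links (L : seq (V * V)) : measurable (disjoint_links L).
Proof.
rewrite [X in measurable X](_ : _ = \bigcup_K
    ([set g : sgraph V | all (fun t => path g t.1 t.2) K] `&`
     [set g : sgraph V | (L == map (@trail_ends V) K) && uniq (trails_edges K)])).
  apply: countable_bigcupT_measurable => [|K]; first exact: countable_trails.
  apply: measurableI.
    elim: K => [|t K IH] /=; first by rewrite (_ : [set _ | _] = setT)//; apply/seteqP.
    rewrite [X in measurable X](_ : _ = [set g : sgraph V | path g t.1 t.2] `&`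
        [set g : sgraph V | all (fun t => path g t.1 t.2) K]).
      by apply: measurableI => //; exact: measurable_path.
    by apply/seteqP; split => [g /andP[]//|g [/= -> ->]].
  case: (_ && _); first by rewrite (_ : [set _ | _] = setT)//; apply/seteqP.
  by rewrite (_ : [set _ | _] = set0)//; apply/seteqP; split.
apply/seteqP; split => [g [K [-> gK uK]]|g [K _ [gK /andP[/eqP -> uK]]]]; last by exists K.
by exists K => //; split=> //=; rewrite eqxx.
Qed.

Definition reach (L : seq (V * V)) (y : V) : set (sgraph V) :=
  [set g | exists2 e, e \in L & connected_in g e.1 y].

Lemma measurable_reach L y : measurable (reach L y).
Proof.
elim: L => [|e L IH].
  by rewrite (_ : reach _ _ = set0)//; apply/seteqP; split=> // g [].
rewrite (_ : reach _ _ = [set g : sgraph V | connected_in g e.1 y] `|` reach L y).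
  by apply: measurableU => //; exact: measurable_connected.
apply/seteqP; split => [g [e']|g [gey|[e' e'L ge'y]]].
- by rewrite inE => /orP[/eqP ->|e'L] ge'y; [left|right; exists e'].
- by exists e => //; rewrite inE eqxx.
- by exists e' => //; rewrite inE e'L orbT.
Qed.

End graph_measurability.

(** * The tree-graph bound *)

Definition BK_measure (R : realType) (V : choiceType)
    (mu : set (sgraph V) -> \bar R) :=
  forall E F : set (sgraph V), measurable E -> measurable F ->
    increasing_event E -> increasing_event F ->
    (mu (disjoint_occurrence E F) <= mu E * mu F)%E.

Section moments.
Context {R : realType} {V : choiceType} (countV : countable [set: V]).
Context (mu : probability (sgraph V) R) (tau : V -> V -> R).
Hypothesis BKmu : BK_measure mu.
Hypothesis tau_ge0 : forall x y, 0 <= tau x y.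
Hypothesis mu_connected : forall x y,
  (mu [set g | connected_in g x y] <= (tau x y)%:E)%E.

Lemma prob_disjoint_links (L : seq (V * V)) :
  (mu (disjoint_links L) <= (\prod_(e <- L) tau e.1 e.2)%:E)%E.
Proof.
elim: L => [|e L IH]; first by rewrite big_nil probability_le1//; exact: measurable_disjoint_links.
rewrite disjoint_links_cons big_cons EFinM.
apply: le_trans (lee_pmul _ _ (mu_connected e.1 e.2) IH); rewrite ?measure_ge0//.
apply: BKmu; [exact: measurable_connected|exact: measurable_disjoint_links|
  exact: increasing_connected|exact: increasing_disjoint_links].
Qed.

Context (Lam : seq V) (e0 : V * V).

Definition reach_count L (g : sgraph V) : R := \sum_(y <- Lam) \1_(reach L y) g.

Lemma reach_count_ge0 L g : 0 <= reach_count L g.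
Proof. by apply: sumr_ge0. Qed.

Lemma le_reach_count L L' g : (forall y, reach L y g -> reach L' y g) ->
  reach_count L g <= reach_count L' g.
Proof.
move=> LL'; apply: ler_sum => y _; rewrite !indicE.
have [/set_mem/LL'/mem_set->//|_] := boolP (g \in reach L y).
by rewrite ler0n.
Qed.

Definition links_moment L k (g : sgraph V) : R :=
  \1_(disjoint_links L) g * reach_count L g ^+ k.

Lemma links_moment_ge0 L k g : 0 <= links_moment L k g.
Proof. by rewrite mulr_ge0// exprn_ge0// reach_count_ge0. Qed.

Lemma measurable_reach_count L : measurable_fun setT (reach_count L).
Proof.
rewrite /reach_count; apply: measurable_sum => y.
exact: measurable_indic (measurable_reach countV _ _).
Qed.

Lemma measurable_links_moment L k : measurable_fun setT (links_moment L k).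
Proof.
apply: measurable_funM.
  exact: measurable_indic (measurable_disjoint_links countV _).
by apply: measurable_funX; exact: measurable_reach_count.
Qed.

(** The skeleton after [v] has been attached at the vertex [z] of the [i]-th
    trail; [e0] is only a default value. *)
Definition graft (L : seq (V * V)) (i : nat) (v z : V) :=
  [:: ((nth e0 L i).1, z), (z, (nth e0 L i).2), (v, z) &
        take i L ++ drop i.+1 L].

Lemma size_graft L (i : 'I_(size L)) v z : size (graft L i v z) = (size L).+2.
Proof.
rewrite /= size_cat size_take size_drop ltn_ord.
by have := ltn_ord i; lia.
Qed.

Lemma reach_graft L (i : 'I_(size L)) v z y g :
  reach L y g -> reach (graft L i v z) y g.
Proof.
move=> [e eL gey].
have : e \in take i L ++ nth e0 L i :: drop i.+1 L by rewrite -drop_nth// cat_take_drop.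
rewrite mem_cat inE => /or3P[eL'|/eqP ei|eL'].
- by exists e => //; rewrite !inE mem_cat eL' !orbT.
- by exists ((nth e0 L i).1, z); [rewrite inE eqxx|rewrite /= -ei].
- by exists e => //; rewrite !inE mem_cat eL' !orbT.
Qed.

(** Pointwise form of the induction on the moments: one factor of the power
    chooses a vertex [v], which is then attached to the skeleton. *)
Lemma links_moment_step (dec : nat -> option V) L k g :
    (forall z, exists n, dec n = Some z) ->
  ((links_moment L k.+1 g)%:E <= \sum_(v <- Lam) \sum_(n <oo) enum_term dec
    (fun z => (\sum_(i < size L) links_moment (graft L i v z) k g)%:E) n)%E.
Proof.
move=> dec_surj.
have T0 v z : 0 <= \sum_(i < size L) links_moment (graft L i v z) k g.
  by apply: sumr_ge0 => i _; exact: links_moment_ge0.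
rewrite /links_moment exprS {1}/reach_count mulrA mulr_sumr mulr_suml -sumEFin.
apply: lee_sum => v _.
have S0 : (0 <= \sum_(n <oo) enum_term dec
    (fun z => (\sum_(i < size L) links_moment (graft L i v z) k g)%:E) n)%E.
  by apply: nneseries_ge0 => n _ _; apply: enum_term_ge0 => z; rewrite lee_fin.
rewrite !indicE; have [/set_mem gL|_] := boolP (g \in _); last by rewrite !mul0r.
have [/set_mem [e eL gev]|_] := boolP (g \in _); last by rewrite mulr0 mul0r.
have eL' := eL; rewrite -index_mem in eL'.
have [i0 [z gz]] := disjoint_links_attach gL eL gev.
pose i : 'I_(size L) := i0.
have nthE : nth e L i0 = nth e0 L i0 by exact: set_nth_default.
rewrite nthE -/(graft L i0 v z) in gz.
have gz0 v' z' : (0 <= (\sum_(i < size L) links_moment (graft L i v' z') k g)%:E)%E.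
  by rewrite lee_fin.
apply: le_trans (enum_series_ge dec_surj z (gz0 v)).
rewrite lee_fin (bigD1 i0)//= mul1r mul1r.
apply: le_trans (_ : links_moment (graft L i0 v z) k g <= _); last first.
  by rewrite lerDl sumr_ge0// => j _; exact: links_moment_ge0.
rewrite /links_moment indicE (mem_set gz) mul1r.
rewrite lerXn2r ?nnegrE ?reach_count_ge0// le_reach_count// => y.
exact: reach_graft.
Qed.

Context (B : R).
Hypothesis B_ge0 : 0 <= B.
Hypothesis tauB : forall x y (Z : seq V), uniq Z ->
  \sum_(v <- Lam) \sum_(z <- Z) tau x z * tau z y * tau v z <= B * tau x y.

Definition weight (L : seq (V * V)) : R := \prod_(e <- L) tau e.1 e.2.

Lemma weight_ge0 L : 0 <= weight L.
Proof. by apply: prodr_ge0. Qed.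

(** Only the trail that is cut changes its weight, so for each of the [size L]
    trails the sum is the one controlled by [B]. *)
Lemma weight_graft_sum L (Z : seq V) : uniq Z ->
  \sum_(v <- Lam) \sum_(z <- Z) \sum_(i < size L) weight (graft L i v z)
    <= (size L)%:R * (B * weight L).
Proof.
move=> uZ; under eq_bigr do rewrite exchange_big.
rewrite exchange_big /=.
rewrite mulr_natl -[X in _ *+ X]card_ord -sumr_const; apply: ler_sum => i _.
have wE : weight L = tau (nth e0 L i).1 (nth e0 L i).2 * weight (take i L ++ drop i.+1 L).
  rewrite /weight -{1}(cat_take_drop i L) (drop_nth e0)// !big_cat /= big_cons.
  by rewrite mulrCA.
rewrite wE mulrA; apply: le_trans (ler_wpM2r (weight_ge0 _) (tauB _ _ uZ)).
rewrite mulr_suml; apply: ler_sum => v _; rewrite mulr_suml; apply: ler_sum => z _.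
by rewrite /weight /graft !big_cons /= !mulrA.
Qed.

(** Induction on [k]: a skeleton of [size L + 2 j] trails offers as many places
    for the next branch, whence the product. *)
Lemma links_moment_le L k : (\int[mu]_g (links_moment L k g)%:E <=
  ((\prod_(j < k) (size L + j.*2)%:R) * B ^+ k * weight L)%:E)%E.
Proof.
have [dec [dec_surj dec_inj]] := countable_enumeration countV.
elim: k L => [|k IH] L.
  rewrite big_ord0 !mul1r; apply: le_trans (prob_disjoint_links L).
  under eq_integral do rewrite /links_moment mulr1.
  by rewrite integral_indic ?setIT//; exact: measurable_disjoint_links.
apply: le_trans (le_integral_nneg _ _ (fun g => links_moment_step L k g dec_surj)) _.
  by move=> g; rewrite lee_fin links_moment_ge0.
pose c : R := (\prod_(j < k) ((size L).+2 + j.*2)%:R) * B ^+ k.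
have c0 : 0 <= c by rewrite mulr_ge0// ?exprn_ge0// prodr_ge0.
have mterm v n : measurable_fun setT (fun g => enum_term dec
    (fun z => (\sum_(i < size L) links_moment (graft L i v z) k g)%:E) n).
  rewrite /enum_term; case: (dec n) => [z|] /=; last exact: measurable_cst.
  apply/measurable_EFinP; apply: measurable_sum => i.
  exact: measurable_links_moment.
have term0 v n g : (0 <= enum_term dec
    (fun z => (\sum_(i < size L) links_moment (graft L i v z) k g)%:E) n)%E.
  by apply: enum_term_ge0 => z; rewrite lee_fin sumr_ge0// => i _; exact: links_moment_ge0.
rewrite ge0_integral_sum//; last 2 first.
- by move=> v; apply: ge0_emeasurable_sum => //.
- by move=> v g _; apply: nneseries_ge0.
under eq_bigr do rewrite integral_nneseries//.
rewrite -nneseries_sum//; last by move=> v n _; apply: integral_ge0.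
apply: (@le_trans _ _ (\sum_(n <oo) enum_term dec (fun z => (\sum_(v <- Lam)
    \sum_(i < size L) c * weight (graft L i v z))%:E) n)%E).
  apply: lee_nneseries => [n _ _|n _].
    by apply: sume_ge0 => v _; exact: integral_ge0.
  rewrite /enum_term; case: (dec n) => [z|] /=; last first.
    by rewrite big1// => v _; rewrite integral0.
  rewrite -sumEFin; apply: lee_sum => v _.
  under eq_integral do rewrite -sumEFin.
  rewrite ge0_integral_sum//; last 2 first.
  - by move=> i; apply/measurable_EFinP; exact: measurable_links_moment.
  - by move=> i g _; rewrite lee_fin links_moment_ge0.
  rewrite -sumEFin; apply: lee_sum => i _.
  by apply: le_trans (IH _) _; rewrite lee_fin size_graft.
apply: enum_series_le => //.
  move=> z; apply: sumr_ge0 => v _; apply: sumr_ge0 => i _.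
  by rewrite mulr_ge0// weight_ge0.
move=> Z uZ; rewrite exchange_big /=.
rewrite (eq_bigr (fun v => c * \sum_(z <- Z) \sum_(i < size L) weight (graft L i v z))); last first.
  by move=> v _; rewrite mulr_sumr; apply: eq_bigr => z _; rewrite mulr_sumr.
rewrite -mulr_sumr; apply: le_trans (ler_wpM2l c0 (weight_graft_sum L uZ)) _.
rewrite big_ord_recl /= addn0 /c exprS.
under [in leRHS]eq_bigr do rewrite /bump /= add1n doubleS !addnS -!addSn.
set P := \prod_(j < k) _.
lra.
Qed.

Lemma prod_odd_le k : \prod_(j < k) (1 + j.*2)%:R <= (2 * k%:R) ^+ k :> R.
Proof.
rewrite -[X in _ ^+ X]card_ord -prodr_const; apply: ler_prod => j _.
rewrite ler0n -natrM ler_nat.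
by have := ltn_ord j; lia.
Qed.

(** Markov's inequality for the [k]-th moment, where the product of odd numbers is
    at most [(2 k) ^ k]; here [k] is free, and is later taken proportional to [s]. *)
Lemma reach_tail (x : V) (s : R) k : 0 < s -> 4 * k%:R * B <= s ->
  (mu [set g | (s <= reach_count [:: (x, x)] g)%R] <= (tau x x * 2^-1 ^+ k)%:E)%E.
Proof.
move=> s0 kBs; set S := [set g | _].
have mS : measurable S.
  rewrite (_ : S = reach_count [:: (x, x)] @^-1` `[s, +oo[%classic).
    by rewrite -[X in measurable X]setTI; apply: measurable_reach_count.
  by apply/seteqP; split=> g /=; rewrite in_itv /= andbT.
have sk0 : 0 < s ^+ k by rewrite exprn_gt0.
have -> : mu S = (\int[mu]_g (\1_S g)%:E)%E by rewrite integral_indic// setIT.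
have le1 g : ((\1_S g)%:E <= (s ^- k)%:E * (links_moment [:: (x, x)] k g)%:E)%E.
  rewrite -EFinM lee_fin /links_moment !indicE (mem_set (disjoint_links_loop g x)) mul1r.
  have [/set_mem gS|_] := boolP (g \in S); last first.
    by rewrite mulr_ge0 ?invr_ge0 ?exprn_ge0 ?reach_count_ge0// ltW.
  rewrite mulrC ler_pdivlMr// mul1r lerXn2r ?nnegrE ?reach_count_ge0//.
  exact: ltW.
apply: le_trans (le_integral_nneg _ _ le1) _.
  by move=> g; rewrite lee_fin.
rewrite ge0_integralZl//; last 3 first.
- by apply/measurable_EFinP; exact: measurable_links_moment.
- by move=> g _; rewrite lee_fin links_moment_ge0.
- by rewrite lee_fin invr_ge0 ltW.
apply: le_trans (lee_wpmul2l _ (links_moment_le _ _)) _.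
  by rewrite lee_fin invr_ge0 ltW.
rewrite -EFinM lee_fin /weight big_seq1 /= mulrC ler_pdivrMr//.
rewrite -[leRHS]mulrA [leRHS]mulrC ler_wpM2r//.
rewrite -exprMn; apply: le_trans (_ : (2 * k%:R) ^+ k * B ^+ k <= _).
  by rewrite ler_wpM2r ?exprn_ge0// prod_odd_le.
rewrite -exprMn lerXn2r ?nnegrE ?mulr_ge0 ?invr_ge0 ?(ltW s0)//.
lra.
Qed.

End moments.

(** * Kernels on a dyadic scale *)

Section geometric.
Context {R : realType}.
Implicit Types r s P Q : R.

Lemma geo_growing_le r n : 1 < r -> \sum_(i < n) r ^+ i <= r ^+ n / (r - 1).
Proof.
move=> r1; have r10 : 0 < r - 1 by rewrite subr_gt0.
rewrite ler_pdivlMr// mulrC -subrX1.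
by rewrite lerBlDr lerDl.
Qed.

Lemma geo_decreasing_le s n m : 0 < s -> s < 1 ->
  \sum_(n <= i < m) s ^+ i <= s ^+ n / (1 - s).
Proof.
move=> s0 s1; have s10 : 0 < 1 - s by rewrite subr_gt0.
have [nm|mn] := leqP n m; last first.
  by rewrite big_geq ?(ltnW mn)// divr_ge0 ?exprn_ge0// ltW.
rewrite -[X in \sum_(X <= _ < _) _]add0n big_addn big_mkord.
under eq_bigr do rewrite exprD.
rewrite -mulr_suml mulrC ler_pM2l ?exprn_gt0//.
rewrite -[leRHS]mul1r ler_pdivlMr// -opprB mulrN mulrC -subrX1 opprB.
by rewrite lerBlDr lerDl exprn_ge0// ltW.
Qed.

(** All sums over dyadic scales grow up to a peak at scale [n] and decay after
    it, so they are of the order of their value at [n]. *)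
Lemma geo_peak_le r s P Q n N : 1 < r -> 0 < s -> s < 1 -> 0 <= P -> 0 <= Q ->
  \sum_(i < N) (if (i < n)%N then P * r ^+ i else Q * s ^+ i) <=
  P * (r ^+ n / (r - 1)) + Q * (s ^+ n / (1 - s)).
Proof.
move=> r1 s0 s1 P0 Q0; have r0 : 0 < r by exact: lt_trans r1.
set f := fun i : nat => if (i < n)%N then P * r ^+ i else Q * s ^+ i.
have f0 i : 0 <= f i.
  by rewrite /f; case: ifP => _; rewrite mulr_ge0// exprn_ge0// ltW.
apply: (@le_trans _ _ (\sum_(i < n + N) f i)).
  rewrite addnC big_split_ord /= lerDl.
  by apply: sumr_ge0.
rewrite -(big_mkord predT f) (big_cat_nat (n := n))//= ?leq_addr//.
apply: lerD.
  rewrite big_mkord (eq_bigr (fun i : 'I_n => P * r ^+ i)); last first.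
    by move=> i _; rewrite /f ltn_ord.
  by rewrite -mulr_sumr ler_wpM2l// geo_growing_le.
rewrite big_nat_cond (eq_bigr (fun i => Q * s ^+ i)); last first.
  by move=> i /andP[/andP[ni _] _]; rewrite /f ltnNge ni.
by rewrite -big_nat_cond -mulr_sumr ler_wpM2l// geo_decreasing_le.
Qed.

End geometric.

(** What remains of the metric space: logarithmic distances, which are an
    ultrametric up to one unit, and the growth of balls. *)
Record dyadic_space (R : realType) (V : choiceType) := DyadicSpace {
  level : V -> V -> nat ;
  ball_seq : V -> nat -> seq V ;
  vol : R ;
  growth : R ;
  level_xx : forall x, level x x = 0%N ;
  level_sym : forall x y, level x y = level y x ;
  level_quasi : forall x y z,
    (level x y <= (maxn (level x z) (level z y)).+1)%N ;
  ball_seq_uniq : forall x i, uniq (ball_seq x i) ;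
  mem_ball_seq : forall x i y, (y \in ball_seq x i) = (level x y <= i)%N ;
  growth_gt0 : 0 < growth ;
  vol_ge0 : 0 <= vol ;
  size_ball_seq : forall x i, (size (ball_seq x i))%:R <= vol * growth ^+ i }.

Section kernels.
Context {R : realType} {V : choiceType} (S : dyadic_space R V).
Local Notation m := (level S).
Local Notation c := (vol S).
Local Notation D := (growth S).
Local Notation m_sym := (level_sym S).
Local Notation m_quasi := (level_quasi S).
Let D_gt0 := growth_gt0 S.
Let c_ge0 := vol_ge0 S.

Lemma ball_size x i (Z : seq V) : uniq Z ->
  {in Z, forall z, (m x z <= i)%N} -> (size Z)%:R <= c * D ^+ i.
Proof.
move=> uZ Zi; apply: le_trans (size_ball_seq S x i); rewrite ler_nat.
by apply: uniq_leq_size => // z /Zi; rewrite mem_ball_seq.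
Qed.

(** Summation over spheres; every sum over vertices below reduces to a sum over
    scales by this lemma. *)
Lemma radial_sum_le (Z : seq V) x (f U : nat -> R) (M : R) :
    (forall i, 0 <= f i) ->
    (forall i, (count (fun z => m x z == i) Z)%:R <= U i) ->
    (forall N, \sum_(i < N) U i * f i <= M) ->
  \sum_(z <- Z) f (m x z) <= M.
Proof.
move=> f0 ZU UM; pose N := (\max_(z <- Z) m x z).+1.
apply: le_trans (UM N).
rewrite [leLHS](_ : _ = \sum_(i < N) (count (fun z => m x z == i) Z)%:R * f i).
  by apply: ler_sum => i _; exact: ler_wpM2r.
transitivity (\sum_(z <- Z) \sum_(i < N) (m x z == i)%:R * f i).
  rewrite big_seq [RHS]big_seq; apply: eq_bigr => z zZ.
  have zN : (m x z < N)%N by rewrite ltnS; exact: leq_bigmax_seq.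
  rewrite (bigD1 (Ordinal zN))//= eqxx mul1r big1 ?addr0// => i.
  by rewrite -val_eqE eq_sym /= => /negbTE ->; rewrite mul0r.
rewrite exchange_big /=; apply: eq_bigr => i _.
rewrite -mulr_suml -sum1_count natr_sum; congr (_ * _).
by rewrite [RHS]big_mkcond /=; apply: eq_bigr => z _; case: eqP.
Qed.

Lemma sphere_count (Z : seq V) x i : uniq Z ->
  (count (fun z => m x z == i) Z)%:R <= c * D ^+ i.
Proof.
move=> uZ; rewrite -size_filter; apply: (ball_size (x := x)); first exact: filter_uniq.
by move=> z; rewrite mem_filter => /andP[/eqP -> _].
Qed.

(** Scales below [i] contribute a growing geometric sum, since [1 < q * D]; every
    other vertex contributes at most [q ^ i], wherever [x] is. *)
Lemma ball_kernel_sum (q : R) x i (Z : seq V) : 0 < q -> q < 1 -> 1 < q * D ->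
    uniq Z -> (size Z)%:R <= c * D ^+ i ->
  \sum_(z <- Z) q ^+ m x z <= c * (1 + (q * D - 1)^-1) * (q * D) ^+ i.
Proof.
move=> q0 q1 qD uZ sZ.
apply: (@le_trans _ _ (\sum_(z <- Z) ((if (m x z < i)%N then q ^+ m x z else 0) + q ^+ i))).
  apply: ler_sum => z _; case: ltnP => h; first by rewrite lerDl exprn_ge0// ltW.
  by rewrite add0r; apply: ler_wiXn2l => //; exact: ltW.
rewrite big_split /= [X in _ + X]big_const_seq count_predT iter_addr_0.
rewrite mulrDr mulr1 mulrDl addrC; apply: lerD.
  rewrite -mulr_natl exprMn_comm; last exact: mulrC.
  by rewrite mulrA mulrAC ler_wpM2r// exprn_ge0// ltW.
apply: (radial_sum_le (f := fun j => if (j < i)%N then q ^+ j else 0)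
  (U := fun j => c * D ^+ j)).
- by move=> j; case: ifP => // _; rewrite exprn_ge0// ltW.
- by move=> j; exact: sphere_count.
move=> N; have h0 : 0 < 2^-1 :> R by rewrite invr_gt0.
have h1 : 2^-1 < 1 :> R by rewrite invf_lt1// ltr1n.
have := @geo_peak_le R (q * D) 2^-1 c 0 i N qD h0 h1 c_ge0 (lexx _).
rewrite mul0r addr0 => peak; rewrite -mulrA (mulrC (_^-1)).
apply: le_trans peak.
apply: ler_sum => j _; case: ifP => _; last by rewrite mulr0 mul0r.
by rewrite exprMn_comm ?(mulrC (q ^+ j)) ?mulrA//; exact: mulrC.
Qed.

Section one_kernel.
Context (a : R).
Hypothesis a_gt0 : 0 < a.
Hypothesis a_lt1 : a < 1.
Hypothesis aD : 1 < a * D.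
Hypothesis aaD : a ^+ 2 * D < 1.

Definition conv_const : R :=
  2 * (c * a^-1 * (a * D - 1)^-1 + c * (1 - a ^+ 2 * D)^-1).

(** The half of the convolution in which [z] is closer to [x] than to [y]: then
    the level of [z, y] is at least that of [x, z], and at least [n - 1] by the
    quasi-ultrametric inequality, [n] being the level of [x, y]. *)
Lemma kernel_half_sum (Z : seq V) x n : uniq Z ->
  \sum_(z <- Z) a ^+ (m x z + maxn (m x z) n.-1) <=
    (c * a^-1 * (a * D - 1)^-1 + c * (1 - a ^+ 2 * D)^-1) * (a ^+ 2 * D) ^+ n.
Proof.
move=> uZ; apply: (radial_sum_le (f := fun i => a ^+ (i + maxn i n.-1))
  (U := fun i => c * D ^+ i)).
- by move=> i; rewrite exprn_ge0// ltW.
- by move=> i; exact: sphere_count.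
move=> N; have aaD0 : 0 < a ^+ 2 * D by rewrite mulr_gt0// exprn_gt0.
have ca0 : 0 <= c * (a^-1 * a ^+ n).
  by rewrite mulr_ge0// mulr_ge0// ?invr_ge0 ?exprn_ge0 ?ltW.
have := @geo_peak_le R (a * D) (a ^+ 2 * D) (c * (a^-1 * a ^+ n)) c n N
  aD aaD0 aaD ca0 c_ge0.
rewrite mulrDl => peak; apply: le_trans; last first.
  apply: le_trans peak _; apply: lerD; last by rewrite mulrA mulrAC.
  rewrite le_eqVlt; apply/orP; left; apply/eqP.
  rewrite (exprMn_comm n (mulrC a D)) (exprMn_comm n (mulrC (a ^+ 2) D)) exprAC expr2.
  lra.
apply: ler_sum => i _; case: ltnP => h.
  have -> : c * (a^-1 * a ^+ n) * (a * D) ^+ i = c * D ^+ i * (a ^+ i * (a^-1 * a ^+ n)).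
    by rewrite (exprMn_comm i (mulrC a D)); lra.
  rewrite ler_wpM2l ?mulr_ge0 ?exprn_ge0 ?(ltW D_gt0)// exprD.
  rewrite ler_wpM2l ?exprn_ge0 ?(ltW a_gt0)//.
  case: n h {ca0 peak} => // n _; rewrite exprS mulrA mulVf ?gt_eqF// mul1r /=.
  by apply: ler_wiXn2l; rewrite ?ltW// leq_maxr.
have -> : (maxn i n.-1) = i by apply/maxn_idPl; lia.
rewrite (exprMn_comm i (mulrC (a ^+ 2) D)) exprAC expr2 exprD.
lra.
Qed.

Lemma kernel_convolution (Z : seq V) x y : uniq Z ->
  \sum_(z <- Z) a ^+ m x z * a ^+ m z y <= conv_const * (a ^+ 2 * D) ^+ m x y.
Proof.
move=> uZ; set n := m x y.
apply: (@le_trans _ _ (\sum_(z <- Z) (a ^+ (m x z + maxn (m x z) n.-1) +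
    a ^+ (m y z + maxn (m y z) n.-1)))).
  apply: ler_sum => z _; have := m_quasi x y z; rewrite -/n -exprD (m_sym y z) => h.
  have [ij|ji] := leqP (m x z) (m z y).
    apply: le_trans (_ : a ^+ (m x z + maxn (m x z) n.-1) <= _).
      by apply: ler_wiXn2l; rewrite ?ltW//; lia.
    by rewrite lerDl exprn_ge0// ltW.
  apply: le_trans (_ : a ^+ (m z y + maxn (m z y) n.-1) <= _).
    by apply: ler_wiXn2l; rewrite ?ltW//; lia.
  by rewrite lerDr exprn_ge0// ltW.
rewrite big_split /= /conv_const -mulrA mulr_natl mulr2n.
by apply: lerD; exact: kernel_half_sum.
Qed.

(** The larger of the two levels is at least that of [x, y] minus one. *)
Lemma kernel_product_le x y z :
  a ^+ m x z * a ^+ m z y <= a^-1 * a ^+ m x y * (a ^+ m x z + a ^+ m z y).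
Proof.
have h := m_quasi x y z.
have aM k : (maxn (m x z) (m z y) <= k)%N -> a ^+ k <= a^-1 * a ^+ m x y.
  move=> hk; rewrite -(ler_pM2l a_gt0) mulrA mulfV ?gt_eqF// mul1r -exprS.
  by apply: ler_wiXn2l; rewrite ?ltW//; lia.
have a0 k : 0 <= a ^+ k by rewrite exprn_ge0// ltW.
have [ij|ji] := leqP (m x z) (m z y).
  rewrite mulrC; apply: ler_pM => //; last by rewrite lerDl.
  by apply: aM; lia.
apply: ler_pM => //; last by rewrite lerDr.
by apply: aM; lia.
Qed.

(** Attaching a branch to the pair [x, y] costs a constant factor: the branching
    point [z] is tied to only one of [x], [y] by [kernel_product_le], and the
    remaining sum over [z] is a convolution. *)
Lemma kernel_triple_sum (C Phi : R) (Lam Z : seq V) x y : 0 <= C -> uniq Z ->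
    (forall u, \sum_(v <- Lam) (a ^+ 2 * D) ^+ m u v <= Phi) ->
  \sum_(v <- Lam) \sum_(z <- Z)
      (C * a ^+ m x z) * (C * a ^+ m z y) * (C * a ^+ m v z)
    <= (2 * C ^+ 2 * a^-1 * conv_const * Phi) * (C * a ^+ m x y).
Proof.
move=> C0 uZ hPhi.
have a0 k : 0 <= a ^+ k by rewrite exprn_ge0// ltW.
have A0 : 0 <= conv_const.
  by rewrite mulr_ge0// addr_ge0// !mulr_ge0// invr_ge0 ?subr_ge0 ltW.
set X := C ^+ 3 * (a^-1 * a ^+ m x y).
have X0 : 0 <= X by rewrite !mulr_ge0// ?exprn_ge0// invr_ge0 ltW.
apply: (@le_trans _ _ (\sum_(v <- Lam) X * (conv_const * (a ^+ 2 * D) ^+ m x v +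
    conv_const * (a ^+ 2 * D) ^+ m y v))).
  apply: ler_sum => v _.
  apply: (@le_trans _ _ (X * (\sum_(z <- Z) a ^+ m x z * a ^+ m z v +
    \sum_(z <- Z) a ^+ m y z * a ^+ m z v))).
    rewrite -big_split /= mulr_sumr; apply: ler_sum => z _.
    have := ler_wpM2l (exprn_ge0 3 C0) (ler_wpM2r (a0 (m v z)) (kernel_product_le x y z)).
    by rewrite /X (m_sym y z) (m_sym z v) !exprS expr0 !mulr1; lra.
  by rewrite ler_wpM2l// lerD// kernel_convolution.
rewrite -mulr_sumr big_split /= -!mulr_sumr.
apply: le_trans (_ : X * (conv_const * Phi + conv_const * Phi) <= _).
  by rewrite ler_wpM2l// lerD// ler_wpM2l.
by rewrite /X !exprS expr0 !mulr1; lra.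
Qed.

End one_kernel.

(** It suffices to bound a potential on its own support: replacing [x] by the
    point of [Lam] nearest to it increases levels by at most one. *)
Lemma kernel_maximum_principle (q Phi : R) (Lam : seq V) x : 0 < q -> q < 1 -> 0 <= Phi ->
    {in Lam, forall u, \sum_(y <- Lam) q ^+ m u y <= Phi} ->
  \sum_(y <- Lam) q ^+ m x y <= q^-1 * Phi.
Proof.
move=> q0 q1 Phi0 hPhi.
case: Lam hPhi => [|y0 Lam'] hPhi.
  by rewrite big_nil mulr_ge0// invr_ge0 ltW.
set Lam := y0 :: Lam' in hPhi *.
have [u uLam umin] : exists2 u, u \in Lam & {in Lam, forall y, (m x u <= m x y)%N}.
  rewrite /Lam; elim: (Lam') (y0) => [|z s IH] y.
    by exists y; rewrite ?inE// => w; rewrite inE => /eqP ->.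
  have [u us umin] := IH z.
  have [h|h] := leqP (m x y) (m x u).
    exists y; first by rewrite inE eqxx.
    by move=> w; rewrite inE => /orP[/eqP ->//|/umin]; exact: leq_trans.
  exists u; first by rewrite inE us orbT.
  by move=> w; rewrite inE => /orP[/eqP ->|/umin//]; exact: ltnW.
apply: le_trans (ler_wpM2l _ (hPhi _ uLam)); last by rewrite invr_ge0 ltW.
rewrite mulr_sumr big_seq [leRHS]big_seq; apply: ler_sum => y yLam.
rewrite -(ler_pM2l q0) mulrA mulfV ?gt_eqF// mul1r -exprS.
apply: ler_wiXn2l; rewrite ?ltW//.
by have := m_quasi u y x; have := umin _ yLam; rewrite (m_sym u x); lia.
Qed.

End kernels.

(** * Tails for one cluster *)

Section measure_bounds.
Context d (T : measurableType d) (R : realType).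
Context (mu : {measure set T -> \bar R}).

Lemma exists_seq_cons (I : eqType) i (s : seq I) (F : I -> set T) :
  [set w | exists2 j, j \in i :: s & F j w] =
  F i `|` [set w | exists2 j, j \in s & F j w].
Proof.
apply/seteqP; split => w /=.
  by move=> [j]; rewrite inE => /orP[/eqP ->|js] Fj; [left|right; exists j].
case=> [Fi|[j js Fj]]; first by exists i; rewrite ?inE ?eqxx.
by exists j; rewrite // inE js orbT.
Qed.

Lemma exists_seq_nil (I : eqType) (F : I -> set T) :
  [set w | exists2 j, j \in [::] & F j w] = set0.
Proof. by apply/seteqP; split=> // w []. Qed.

Lemma measurable_exists_seq (I : eqType) (s : seq I) (F : I -> set T) :
  (forall i, measurable (F i)) -> measurable [set w | exists2 i, i \in s & F i w].
Proof.
move=> mF; elim: s => [|i s IH]; first by rewrite exists_seq_nil.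
by rewrite exists_seq_cons; exact: measurableU.
Qed.

Lemma measure_exists_seq_le (I : eqType) (s : seq I) (F : I -> set T) :
  (forall i, measurable (F i)) ->
  (mu [set w | exists2 i, i \in s & F i w] <= \sum_(i <- s) mu (F i))%E.
Proof.
move=> mF; elim: s => [|i s IH]; first by rewrite exists_seq_nil measure0 big_nil.
rewrite exists_seq_cons big_cons; apply: le_trans (leeD2l _ IH).
by apply: measureU2 => //; exact: measurable_exists_seq.
Qed.

End measure_bounds.

Section cluster_tail.
Context {R : realType} {V : choiceType} (countV : countable [set: V]).
Context (S : dyadic_space R V).
Local Notation m := (level S).
Local Notation D := (growth S).

Definition cluster_count (Lam : seq V) (x : V) (g : sgraph V) : R :=
  \sum_(y <- Lam) \1_[set h : sgraph V | connected_in h x y] g.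

Lemma cluster_countE Lam x g :
  cluster_count Lam x g = (count (fun y => `[<connected_in g x y>]) Lam)%:R.
Proof.
rewrite /cluster_count -sum1_count natr_sum [RHS]big_mkcond; apply: eq_bigr => y _.
rewrite indicE; have [h|h] := pselect (connected_in g x y).
  by rewrite asboolT// mem_set.
by rewrite asboolF// memNset.
Qed.

Lemma measurable_cluster_count Lam x : measurable_fun setT (cluster_count Lam x).
Proof.
by apply: measurable_sum => y; exact: measurable_indic (measurable_connected countV _ _).
Qed.

Lemma measurable_cluster_count_ge Lam x (s : R) :
  measurable [set g | s <= cluster_count Lam x g].
Proof.
rewrite (_ : [set _ | _] = cluster_count Lam x @^-1` `[s, +oo[%classic).
  by rewrite -[X in measurable X]setTI; apply: measurable_cluster_count.
by apply/seteqP; split=> g /=; rewrite in_itv /= andbT.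
Qed.

(** For [a = 2 ^ -alpha] and [D = 2 ^ d] this is [d / 2 < alpha < d]. *)
Definition intermediate_ratio (a : R) :=
  [/\ 0 < a, a < 1, 1 < a * D & a ^+ 2 * D < 1].

Context (mu : probability (sgraph V) R) (a C : R).
Hypothesis BKmu : BK_measure mu.
Hypothesis a_mid : intermediate_ratio a.
Hypothesis C_ge0 : 0 <= C.
Hypothesis mu_connected : forall x y,
  (mu [set g | connected_in g x y] <= (C * a ^+ m x y)%:E)%E.

(** Markov's inequality with a moment of order [k], the number of multiples of
    [A * Phi] below [s]: an exponential tail on the scale [Phi]. *)
Lemma cluster_tail : exists2 A : R, 0 < A &
  forall (Lam : seq V) (Phi s : R) k x, 0 <= Phi ->
    (forall u, \sum_(v <- Lam) (a ^+ 2 * D) ^+ m u v <= Phi) ->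
    0 < s -> A * k%:R * Phi <= s ->
  (mu [set g | (s <= cluster_count Lam x g)%R] <= (C * 2^-1 ^+ k)%:E)%E.
Proof.
case: a_mid => a0 a1 aD aaD; have D0 := growth_gt0 S; have c0 := vol_ge0 S.
have conv0 : 0 <= conv_const S a.
  by rewrite mulr_ge0// addr_ge0// !mulr_ge0// invr_ge0 ?subr_ge0 ltW.
have ca0 : 0 <= 2 * C ^+ 2 / a * conv_const S a.
  apply: mulr_ge0 => //; apply: mulr_ge0; last by rewrite invr_ge0 ltW.
  by rewrite mulr_ge0// exprn_ge0.
exists (4 * (2 * C ^+ 2 / a * conv_const S a) + 1).
  by rewrite ltr_wpDl// mulr_ge0.
move=> Lam Phi s k x Phi0 hPhi s0 hs.
have tau0 x' y : 0 <= C * a ^+ m x' y by rewrite mulr_ge0// exprn_ge0// ltW.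
have := @reach_tail R V countV mu (fun x y => C * a ^+ m x y) BKmu tau0 mu_connected
  Lam (x, x) _ _ (fun x' y' Z uZ => kernel_triple_sum a0 a1 aD aaD x' y' C_ge0 uZ hPhi) x s k s0.
rewrite level_xx expr0 mulr1.
have -> : reach_count Lam [:: (x, x)] = cluster_count Lam x :> (sgraph V -> R).
  apply/funext => g; apply: eq_bigr => y _; congr (\1_ _ g).
  apply/seteqP; split => h /=; first by case=> e; rewrite inE => /eqP ->.
  by exists (x, x) => //; rewrite inE eqxx.
apply.
  by rewrite mulr_ge0.
apply: le_trans hs.
set K := 2 * C ^+ 2 / a * conv_const S a in ca0 *.
have kP : 0 <= k%:R * Phi by rewrite mulr_ge0.
lra.
Qed.

(** For a ball the scale [Phi] is given by [ball_kernel_sum], uniformly in the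
    centre of the ball. *)
Lemma local_volume_tail : exists2 K : R, 0 < K &
  forall k u i x, (0 < k)%N ->
  (mu [set g | (K * k%:R * (a ^+ 2 * D * D) ^+ i <= cluster_count (ball_seq S u i) x g)%R]
    <= (C * 2^-1 ^+ k)%:E)%E.
Proof.
case: a_mid => a0 a1 aD aaD; have D0 := growth_gt0 S; have c0 := vol_ge0 S.
have [A A0 hA] := cluster_tail.
have aaD0 : 0 < a ^+ 2 * D by rewrite mulr_gt0// exprn_gt0.
have aaDD : 1 < a ^+ 2 * D * D.
  by rewrite expr2 -mulrA mulrACA -expr2 exprn_egt1.
pose c1 := vol S * (1 + (a ^+ 2 * D * D - 1)^-1) + 1.
have c10 : 0 < c1.
  by rewrite ltr_wpDl// mulr_ge0// addr_ge0// invr_ge0 subr_ge0 ltW.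
exists (A * c1); first exact: mulr_gt0.
move=> k u i x k0; apply: (hA _ (c1 * (a ^+ 2 * D * D) ^+ i)).
- by rewrite mulr_ge0 ?exprn_ge0// ltW// mulr_gt0.
- move=> v; apply: le_trans (ball_kernel_sum v aaD0 aaD aaDD (ball_seq_uniq S u i)
    (size_ball_seq S u i)) _.
  by rewrite ler_wpM2r ?exprn_ge0 ?lerDl// ltW// mulr_gt0.
- by rewrite !mulr_gt0 ?exprn_gt0 ?ltr0n// mulr_gt0.
- by rewrite le_eqVlt; apply/orP; left; apply/eqP; lra.
Qed.

End cluster_tail.

(** * Intersection of two independent clusters *)

Section sparse_clusters.
Context {R : realType} {V : choiceType} (S : dyadic_space R V).
Local Notation m := (level S).
Local Notation D := (growth S).

(** Spheres of level [i < r] are bounded by the volume of the space, larger ones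
    by the sparseness of the cluster.  Since [K] is of order [q ^ -r], the two
    bounds agree at [i = r], and the peak of the sum sits there. *)
Lemma sparse_kernel_sum (q q2 K0 K : R) (r N : nat) o (Lam : seq V) (g : sgraph V) :
    0 < q -> 0 < q2 -> q2 < 1 -> 1 < q2 * D -> q * q2 * D < 1 ->
    0 <= K0 -> 0 <= K -> K <= K0 * q^-1 ^+ r ->
    uniq Lam -> {in Lam, forall y, (m o y <= N)%N /\ connected_in g o y} ->
    (forall u i, u \in ball_seq S o N -> (i <= N.+1)%N ->
      cluster_count (ball_seq S u i) o g <= K * (q * D) ^+ i) ->
  forall u, \sum_(y <- Lam) q2 ^+ m u y <=
    q2^-1 * ((vol S / (q2 * D - 1) + K0 / (1 - q * q2 * D)) * (q2 * D) ^+ r).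
Proof.
move=> q0 q20 q21 q2D qq2D K00 K_0 KK0 uLam hLam sparse u.
have c0 := vol_ge0 S; have D0 := growth_gt0 S.
have qq2D0 : 0 < q * q2 * D by rewrite !mulr_gt0.
have q2D0 : 0 < q2 * D by rewrite mulr_gt0.
apply: kernel_maximum_principle => //.
  rewrite mulr_ge0 ?exprn_ge0 ?(ltW q2D0)//.
  by rewrite addr_ge0// mulr_ge0// invr_ge0 subr_ge0 ltW.
move=> {}u uL; have [ou gou] := hLam _ uL.
apply: (radial_sum_le (S := S) (f := fun i => q2 ^+ i)
  (U := fun i => if (i < r)%N then vol S * D ^+ i else K * (q * D) ^+ i)).
- by move=> i; rewrite exprn_ge0// ltW.
- move=> i; case: ltnP => _; first exact: sphere_count.
  have [iN|Ni] := leqP i N.+1; last first.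
    rewrite (_ : count _ _ = 0%N).
      by rewrite mulr_ge0// exprn_ge0// mulr_ge0// ltW.
    apply/eqP; rewrite -leqn0 leqNgt -has_count; apply/hasPn => y yL.
    have [oy _] := hLam _ yL.
    apply: contraTneq Ni => <-; rewrite -leqNgt.
    apply: leq_trans (level_quasi S u y o) _.
    by rewrite ltnS geq_max (level_sym S u) ou oy.
  apply: le_trans (sparse u i _ iN); last by rewrite mem_ball_seq.
  rewrite cluster_countE ler_nat -!size_filter.
  apply: uniq_leq_size; first exact: filter_uniq.
  move=> y; rewrite !mem_filter => /andP[/eqP ui yL].
  have [_ gy] := hLam _ yL.
  by rewrite mem_ball_seq ui leqnn andbT; apply/asboolP.
move=> M; have := @geo_peak_le R (q2 * D) (q * q2 * D) (vol S) K r M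
  q2D qq2D0 qq2D c0 K_0.
move=> peak; apply: (le_trans _ (le_trans peak _)).
  apply: ler_sum => i _; case: ifP => _.
    by rewrite (exprMn_comm i (mulrC q2 D)) mulrAC mulrA.
  by rewrite !exprMn -!mulrA ler_wpM2l// !mulrA [leLHS]mulrAC.
rewrite mulrDl lerD//; first by rewrite mulrA mulrAC.
rewrite mulrA [leRHS]mulrAC ler_wpM2r//; first by rewrite invr_ge0 subr_ge0 ltW.
rewrite -!mulrA exprMn mulrA ler_wpM2r ?exprn_ge0 ?(ltW q2D0)//.
apply: le_trans (ler_wpM2r _ KK0) _; first by rewrite exprn_ge0// ltW.
by rewrite -mulrA -exprMn mulVf ?gt_eqF// expr1n mulr1.
Qed.

End sparse_clusters.

Section two_graphs.
Context {R : realType} {V : choiceType} (countV : countable [set: V]).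
Context (S : dyadic_space R V).
Local Notation m := (level S).
Local Notation D := (growth S).
Context d (Omega : measurableType d) (P : probability Omega R)
  (G1 G2 : {RV P >-> sgraph V}).
Hypothesis indepG : independent_graphs G1 G2.
Context (o : V).

Lemma measurable_preimage_graph (G : {RV P >-> sgraph V}) (E : set (sgraph V)) :
  measurable E -> measurable (G @^-1` E).
Proof. by move=> mE; rewrite -[X in measurable X]setTI; exact: measurable_funP. Qed.

Lemma far_intersection (a b C : R) (N : nat) : 0 < a -> 0 < b -> a * b * D < 1 -> 0 <= C ->
    (forall x y, (P [set w | connected_in (G1 w) x y] <= (C * a ^+ m x y)%:E)%E) ->
    (forall x y, (P [set w | connected_in (G2 w) x y] <= (C * b ^+ m x y)%:E)%E) ->
  let far := [set w | exists y, [/\ (N < m o y)%N, connected_in (G1 w) o y &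
                                    connected_in (G2 w) o y]] in
  measurable far /\
  (P far <= (C ^+ 2 * vol S / (1 - a * b * D) * (a * b * D) ^+ N.+1)%:E)%E.
Proof.
move=> a0 b0 abD C0 conn1 conn2 far; have c0 := vol_ge0 S; have D0 := growth_gt0 S.
have [dec [dec_surj dec_inj]] := countable_enumeration countV.
pose E y := if (N < m o y)%N then G1 @^-1` [set g | connected_in g o y] `&`
  G2 @^-1` [set g | connected_in g o y] else set0.
have mE y : measurable (E y).
  rewrite /E; case: ifP => _ //; apply: measurableI;
  by apply: measurable_preimage_graph; exact: measurable_connected.
pose F n := oapp E set0 (dec n).
have mF n : measurable (F n) by rewrite /F; case: (dec n) => [y|] /=.
have farE : far = \bigcup_n F n.
  apply/seteqP; split => [w [y [Ny c1 c2]]|w [n _]].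
    have [n ny] := dec_surj y; exists n => //.
    by rewrite /F ny /= /E Ny.
  rewrite /F; case: (dec n) => [y|//] /=; rewrite /E; case: ifP => // Ny [c1 c2].
  by exists y.
have mfar : measurable far by rewrite farE; exact: bigcup_measurable.
split=> //; apply: le_trans (measure_sigma_subadditive P mF mfar _) _.
  by rewrite farE.
pose f i : R := if (N < i)%N then C ^+ 2 * (a * b) ^+ i else 0.
have f0 i : 0 <= f i.
  by rewrite /f; case: ifP => // _; rewrite mulr_ge0// exprn_ge0// ltW// mulr_gt0.
apply: (@le_trans _ _ (\sum_(n <oo) enum_term dec (fun y => (f (m o y))%:E) n)%E).
  apply: lee_nneseries => [n _ _|n _]; first exact: measure_ge0.
  rewrite /F /enum_term; case: (dec n) => [y|] /=; last by rewrite measure0.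
  rewrite /E /f; case: ifP => _; last by rewrite measure0.
  rewrite indepG; [|exact: measurable_connected|exact: measurable_connected].
  apply: le_trans (lee_pmul _ _ (conn1 _ _) (conn2 _ _)) _; rewrite ?measure_ge0//.
  by rewrite -EFinM lee_fin exprMn expr2 mulrACA.
apply: enum_series_le => // Z uZ.
have abD0 : 0 < a * b * D by rewrite !mulr_gt0.
apply: (radial_sum_le (S := S) (f := f) (U := fun i => vol S * D ^+ i)) => //.
  by move=> i; exact: sphere_count.
move=> M; have h2 : 1 < 2 :> R by rewrite ltr1n.
have := @geo_peak_le R 2 (a * b * D) 0 (C ^+ 2 * vol S) N.+1 M h2 abD0 abD (lexx _).
have Cc : 0 <= C ^+ 2 * vol S by rewrite mulr_ge0// exprn_ge0.
move=> /(_ Cc); rewrite mul0r add0r => peak.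
apply: (le_trans _ (le_trans peak _)); last by rewrite mulrA mulrAC.
apply: ler_sum => i _; rewrite /f ltnS; case: leqP => _; first by rewrite mulr0 mul0r.
rewrite [in leRHS]exprMn; lra.
Qed.

Definition cluster_trace (bs : seq V) (g : sgraph V) : seq V :=
  [seq y <- bs | `[<connected_in g o y>]].

Lemma measurable_pattern (bs : seq V) (t : seq bool) :
  measurable [set g : sgraph V | map (fun y => `[<connected_in g o y>]) bs = t].
Proof.
elim: bs t => [|y bs IH] [|b t].
- by rewrite (_ : [set _ | _] = setT)//; apply/seteqP.
- by rewrite (_ : [set _ | _] = set0)//; apply/seteqP; split=> g //=.
- by rewrite (_ : [set _ | _] = set0)//; apply/seteqP; split=> g //=.
rewrite (_ : [set _ | _] = [set g : sgraph V | `[<connected_in g o y>] = b] `&`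
    [set g : sgraph V | map (fun y => `[<connected_in g o y>]) bs = t]).
  apply: measurableI => //; case: b.
    rewrite (_ : [set _ | _] = [set g | connected_in g o y]).
      exact: measurable_connected.
    by apply/seteqP; split => g /=; [move=> /asboolP|move=> h; exact/asboolP].
  rewrite (_ : [set _ | _] = ~` [set g | connected_in g o y]).
    by apply: measurableC; exact: measurable_connected.
  by apply/seteqP; split => g /=; [move=> /asboolPn|move=> h; exact/asboolPn].
by apply/seteqP; split => [g /= [h1 h2]|g [/= -> ->]].
Qed.

(** Conditioning on the trace of the first cluster.  A trace in a finite set takes
    finitely many values, so independence enters through a finite sum over these
    values. *)
Lemma dense_intersection (bs : seq V) (good : seq V -> Prop) (s eps : R) : 0 <= eps ->
    (forall Lam, good Lam ->
      (P [set w | (s <= cluster_count Lam o (G2 w))%R] <= eps%:E)%E) ->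
  let dense := [set w | good (cluster_trace bs (G1 w)) /\
                        s <= cluster_count (cluster_trace bs (G1 w)) o (G2 w)] in
  measurable dense /\ (P dense <= eps%:E)%E.
Proof.
move=> eps0 hgood dense.
pose pat (g : sgraph V) := map (fun y => `[<connected_in g o y>]) bs.
have mpat (t : (size bs).-tuple bool) : measurable [set w | pat (G1 w) = t].
  exact: (measurable_preimage_graph G1 (measurable_pattern bs t)).
pose F (t : (size bs).-tuple bool) :=
  if pselect (good (mask t bs)) then [set w | pat (G1 w) = t] `&`
    [set w | s <= cluster_count (mask t bs) o (G2 w)] else set0.
have mF t : measurable (F t).
  rewrite /F; case: pselect => [gt|ngt]; last exact: measurable0.
  apply: measurableI; first exact: mpat.
  exact: (measurable_preimage_graph G2
    (measurable_cluster_count_ge countV (mask t bs) o s)).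
have traceE w : cluster_trace bs (G1 w) = mask (pat (G1 w)) bs by rewrite /cluster_trace filter_mask.
have patP w : exists t : (size bs).-tuple bool, pat (G1 w) = t.
  have spat : size (pat (G1 w)) == size bs by rewrite size_map.
  by exists (Tuple spat).
have denseE : dense = [set w | exists2 t, t \in enum {: (size bs).-tuple bool} & F t w].
  apply/seteqP; split => [w [gt st]|w].
    have [t pt] := patP w; rewrite traceE pt in gt st.
    by exists t; [rewrite mem_enum|rewrite /F; case: pselect].
  case=> t _; rewrite /F; case: pselect => // gt [/= pt st].
  by split; rewrite traceE pt.
rewrite denseE; split; first exact: measurable_exists_seq.
apply: le_trans (measure_exists_seq_le P _ mF) _.
have part : (\sum_(t <- enum {: (size bs).-tuple bool}) P [set w | pat (G1 w) = t] = 1)%E.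
  rewrite (eq_bigr (fun t : (size bs).-tuple bool =>
    \int[P]_w (\1_[set w | pat (G1 w) = t] w)%:E)%E); last first.
    by move=> t _; rewrite integral_indic ?setIT//; exact: mpat.
  rewrite -ge0_integral_sum//; last first.
    move=> t; apply/measurable_EFinP; apply: measurable_indic; exact: mpat.
  rewrite (eq_integral (fun=> 1%E)) => [|w _].
    by rewrite integral_cst//= mul1e; exact: probability_setT.
  have [t pt] := patP w.
  rewrite sumEFin big_enum /= (bigD1 t)//= indicE mem_set// big1 ?addr0// => t' tt'.
  rewrite indicE memNset//= pt => /val_inj tt'E.
  by rewrite tt'E eqxx in tt'.
apply: (@le_trans _ _ (\sum_(t <- enum {: (size bs).-tuple bool})
    eps%:E * P [set w | pat (G1 w) = t])%E).
  apply: lee_sum => t _; rewrite /F; case: pselect => [gt|ngt]; last first.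
    by rewrite measure0 mule_ge0// lee_fin.
  rewrite [leLHS](indepG (measurable_pattern bs t)
    (measurable_cluster_count_ge countV (mask t bs) o s)).
  rewrite muleC; apply: lee_wpmul2r => //; exact: hgood.
rewrite -ge0_sume_distrr; last by move=> t _; exact: measure_ge0.
by rewrite part mule1.
Qed.

End two_graphs.

Lemma half_pow_bound (R : realType) n : (n%:R + 2) * 2^-1 ^+ n <= 2 :> R.
Proof.
elim: n => [|n IH]; first by rewrite add0r mulr1.
apply: le_trans IH; rewrite exprS -natr1.
have h : 0 <= 2^-1 ^+ n :> R by rewrite exprn_ge0// invr_ge0.
have n0 : 0 <= n%:R :> R by [].
have := mulr_ge0 n0 h; set x := n%:R; set e := _ ^+ n in h *; lra.
Qed.

Section intersection_tail.
Context {R : realType} {V : choiceType} (countV : countable [set: V]).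
Context (S : dyadic_space R V).
Local Notation m := (level S).
Local Notation D := (growth S).
Context d (Omega : measurableType d) (P : probability Omega R)
  (G1 G2 : {RV P >-> sgraph V}).
Hypothesis indepG : independent_graphs G1 G2.
Hypothesis BK1 : BK_inequality G1.
Hypothesis BK2 : BK_inequality G2.
Context (o : V) (a b C : R).
Hypothesis a_mid : intermediate_ratio S a.
Hypothesis b_mid : intermediate_ratio S b.
Hypothesis abD : (a ^+ 2 * D) * (b ^+ 2 * D) * D < 1.
Hypothesis C_ge0 : 0 <= C.
Hypothesis conn1 : forall x y,
  (P [set w | connected_in (G1 w) x y] <= (C * a ^+ m x y)%:E)%E.
Hypothesis conn2 : forall x y,
  (P [set w | connected_in (G2 w) x y] <= (C * b ^+ m x y)%:E)%E.

Lemma counting_le_size (A : set V) (s : seq V) :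
  A `<=` [set` s] -> (counting A <= (size s)%:R%:E :> \bar R)%E.
Proof.
move=> As; have finA : finite_set A by apply: sub_finite_set As _; exact: finite_seq.
rewrite /counting asboolT// lee_fin ler_nat.
apply: uniq_leq_size; first exact: finmap.fset_uniq.
by move=> y; rewrite in_fset_set// => /set_mem/As.
Qed.

(** The bad event says that the clusters meet far away, or that the first one is
    crowded in some ball, or that the second one is large on the trace of the
    first.  The factor [p] pays for the union bound over the [vol S * D ^ N]
    centres and the [N + 2] levels. *)
Lemma intersection_tail : exists (p : nat) (theta A A' : R),
  [/\ (0 < p)%N, 0 < theta, theta < 1 & 0 < A] /\
  forall r N : nat, (p * N)%:R <= (a ^+ 2 * D)^-1 ^+ r ->
  exists Bad : set Omega, [/\ measurable Bad, (P Bad <= (A' * theta ^+ N)%:E)%E &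
    forall w, ~ Bad w ->
      (counting (graph_cluster (G1 w) o `&` graph_cluster (G2 w) o) <=
       (A * (b ^+ 2 * D * D / (a ^+ 2 * D)) ^+ r)%:E)%E].
Proof.
case: (a_mid) => a0 a1 aD aaD; case: (b_mid) => b0 b1 bD bbD.
have D0 := growth_gt0 S; have c0 := vol_ge0 S.
have qq2D := abD.
set q := a ^+ 2 * D in qq2D aaD *; set q2 := b ^+ 2 * D in qq2D bbD *.
have q0 : 0 < q by rewrite mulr_gt0// exprn_gt0.
have q20 : 0 < q2 by rewrite mulr_gt0// exprn_gt0.
have q2D : 1 < q2 * D by rewrite /q2 expr2 -mulrA mulrACA -expr2 exprn_egt1.
have q2D0 : 0 < q2 * D by rewrite mulr_gt0.
have abD0 : 0 < a * b * D by rewrite !mulr_gt0.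
have abD1 : a * b * D < 1.
  rewrite -(@expr_lt1 _ 2)// ?ltW//.
  have -> : (a * b * D) ^+ 2 = q * q2 by rewrite /q /q2 !exprMn !expr2; lra.
  by rewrite mulr_ilt1// ltW.
have [K1 K10 crowd] := local_volume_tail countV (mu := distribution P G1)
  BK1 a_mid C_ge0 conn1.
have [A2 A20 tail2] := cluster_tail countV (mu := distribution P G2)
  BK2 b_mid C_ge0 conn2.
have [p [p0 pD]] : exists p : nat, (0 < p)%N /\ D * 2^-1 ^+ p <= 4^-1.
  exists (Num.bound (4 * D)).+1; split=> //.
  have := @upper_nthrootP R (4 * D) (Num.bound (4 * D)).+1 (leqnSn _).
  rewrite exprVn ler_pdivrMr ?exprn_gt0// ; lra.
pose K3 : R := vol S / (q2 * D - 1) + K1 / (1 - q * q2 * D).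
have K30 : 0 < K3.
  rewrite ltr_wpDl// ?divr_gt0 ?subr_gt0//.
  by rewrite divr_ge0// subr_ge0 ltW.
pose theta := Num.max 2^-1 (a * b * D).
have theta0 : 0 < theta by rewrite lt_max abD0 orbT.
pose A' : R := 1 + C ^+ 2 * vol S / (1 - a * b * D) + 2 * vol S * C + C.
have Cc0 : 0 <= C ^+ 2 * vol S / (1 - a * b * D).
  by rewrite !mulr_ge0 ?exprn_ge0// invr_ge0 subr_ge0 ltW.
exists p, theta, (A2 * (q2^-1 * K3)), A'; split.
  split=> //; last by rewrite !mulr_gt0// invr_gt0.
  by rewrite gt_max abD1 andbT invf_lt1// ltr1n.
(* For [N = 0] the thresholds of the tail bounds vanish; the whole space serves as
   bad event, since [1 <= A']. *)
move=> r N pN; have [->|N0] := posnP N.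
  exists setT; split=> [//||w /(_ I)//]; rewrite [P _]probability_setT expr0 mulr1 lee_fin /A'.
  have : 0 <= vol S * C by rewrite mulr_ge0.
  move: Cc0 C_ge0; lra.
pose k := (p * N)%N; have k0 : (0 < k)%N by rewrite muln_gt0 p0.
have Nq : N%:R <= q^-1 ^+ r.
  by apply: le_trans pN; rewrite ler_nat leq_pmull.
have qr0 : 0 < q^-1 ^+ r by rewrite exprn_gt0// invr_gt0.
have [mfar Pfar] := far_intersection countV indepG o N a0 b0 abD1 C_ge0 conn1 conn2.
set far := [set w | _] in mfar Pfar.
pose idx := [seq (u, i) | u <- ball_seq S o N, i <- iota 0 N.+2].
pose crowded1 (ui : V * nat) : set Omega := G1 @^-1`
  [set g | (K1 * k%:R * (q * D) ^+ ui.2 <= cluster_count (ball_seq S ui.1 ui.2) o g)%R].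
have mcrowded1 ui : measurable (crowded1 ui).
  by apply: measurable_preimage_graph; exact: measurable_cluster_count_ge.
pose crowded := [set w | exists2 ui, ui \in idx & crowded1 ui w].
have mcrowded : measurable crowded by exact: measurable_exists_seq.
have Pcrowded : (P crowded <= (2 * vol S * C * 2^-1 ^+ N)%:E)%E.
  apply: le_trans (measure_exists_seq_le P idx mcrowded1) _.
  apply: (@le_trans _ _ (\sum_(ui <- idx) (C * 2^-1 ^+ k)%:E)%E).
    by apply: lee_sum => ui _; exact: crowd.
  rewrite sumEFin lee_fin big_const_seq count_predT iter_addr_0.
  rewrite size_allpairs size_iota -[leLHS]mulr_natr natrM.
  apply: le_trans (_ : C * 2^-1 ^+ k * (vol S * D ^+ N * N.+2%:R) <= _).
    rewrite ler_wpM2l ?mulr_ge0 ?exprn_ge0 ?invr_ge0//.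
    by rewrite ler_wpM2r ?size_ball_seq.
  have hk : D ^+ N * 2^-1 ^+ k <= 4^-1 ^+ N.
    by rewrite /k exprM -exprMn lerXn2r// nnegrE ?invr_ge0// mulr_ge0 ?exprn_ge0 ?invr_ge0 ?ltW.
  have -> : C * 2^-1 ^+ k * (vol S * D ^+ N * N.+2%:R) =
    (C * vol S * N.+2%:R) * (D ^+ N * 2^-1 ^+ k) by lra.
  apply: le_trans (ler_wpM2l _ hk) _; first by rewrite !mulr_ge0.
  have -> : 4^-1 = 2^-1 * 2^-1 :> R by lra.
  rewrite exprMn; set e := 2^-1 ^+ N.
  have e0 : 0 <= e by rewrite exprn_ge0// invr_ge0.
  have := half_pow_bound R N; rewrite -/e.
  have -> : N.+2%:R = N%:R + 2 :> R by rewrite -addn2 natrD.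
  move=> he; have := ler_wpM2l (mulr_ge0 (mulr_ge0 C_ge0 c0) e0) he; lra.
pose Phi := q2^-1 * (K3 * (q2 * D) ^+ r).
have Phi0 : 0 < Phi by rewrite !mulr_gt0// ?invr_gt0// exprn_gt0.
pose s := A2 * q^-1 ^+ r * Phi.
pose good Lam := forall u, \sum_(y <- Lam) q2 ^+ m u y <= Phi.
have CN0 : 0 <= C * 2^-1 ^+ N by rewrite mulr_ge0// exprn_ge0// invr_ge0.
have Pgood Lam : good Lam ->
    (P [set w | (s <= cluster_count Lam o (G2 w))%R] <= (C * 2^-1 ^+ N)%:E)%E.
  move=> gLam; apply: (tail2 Lam Phi s N o (ltW Phi0) gLam).
    by apply: mulr_gt0 => //; exact: mulr_gt0.
  by rewrite /s ler_wpM2r ?(ltW Phi0)// ler_wpM2l ?(ltW A20).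
have [mdense Pdense] := dense_intersection countV indepG (ball_seq S o N) CN0 Pgood.
set dense := [set w | _] in mdense Pdense.
exists (far `|` (crowded `|` dense)); split.
- by apply: measurableU => //; exact: measurableU.
- apply: le_trans (measureU2 _ _ _) _ => //; first exact: measurableU.
  apply: le_trans (leeD Pfar (le_trans (measureU2 _ _ _) (leeD Pcrowded Pdense))) _ => //.
  rewrite -!EFinD lee_fin.
  have t1 : (a * b * D) ^+ N.+1 <= theta ^+ N.
    rewrite exprS; apply: le_trans (_ : 1 * (a * b * D) ^+ N <= _).
      by rewrite ler_wpM2r ?exprn_ge0 ?ltW.
    by rewrite mul1r lerXn2r ?nnegrE ?(ltW abD0) ?(ltW theta0)// /theta le_max lexx orbT.
  have t2 : 2^-1 ^+ N <= theta ^+ N.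
    by rewrite lerXn2r ?nnegrE ?invr_ge0 ?(ltW theta0)// /theta le_max lexx.
  have t0 : 0 <= theta ^+ N by rewrite exprn_ge0// ltW.
  have := ler_wpM2l Cc0 t1.
  have vC : 0 <= 2 * vol S * C by rewrite !mulr_ge0.
  have := ler_wpM2l vC t2; have := ler_wpM2l C_ge0 t2.
  by rewrite /A' !mulrDl mul1r; lra.
move=> w /not_orP[nfar /not_orP[ncrowded ndense]].
pose Lam := cluster_trace o (ball_seq S o N) (G1 w).
have gLam : good Lam.
  apply: (sparse_kernel_sum (q := q) (K0 := K1) (K := K1 * k%:R) (N := N) (o := o) (g := G1 w)) => //.
  - by rewrite ltW.
  - by rewrite mulr_ge0// ltW.
  - by rewrite ler_wpM2l// ltW.
  - exact: filter_uniq (ball_seq_uniq _ _ _).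
  - move=> y; rewrite mem_filter mem_ball_seq => /andP[/asboolP oy ->].
    by split.
  - move=> u i uN iN; rewrite leNgt; apply/negP => h; apply: ncrowded.
    exists (u, i); last exact: ltW.
    by apply/allpairsP; exists (u, i); split; rewrite ?mem_iota.
have slt : cluster_count Lam o (G2 w) < s.
  by rewrite ltNge; apply/negP => h; apply: ndense; split.
apply: (@le_trans _ _ (s%:E)); last first.
  rewrite lee_fin /s /Phi -mulrA.
  have -> : q^-1 ^+ r * (q2^-1 * (K3 * (q2 * D) ^+ r)) =
    (q2^-1 * K3) * ((q2 * D) ^+ r * q^-1 ^+ r) by lra.
  by rewrite -exprMn mulrA.
apply: le_trans (counting_le_size (s := [seq y <- Lam | `[<connected_in (G2 w) o y>]]) _) _.
  move=> y [c1 c2] /=; rewrite mem_filter mem_filter mem_ball_seq.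
  rewrite !asboolT//= leqNgt; apply/negP => Ny; apply: nfar.
  by exists y.
by rewrite lee_fin size_filter -cluster_countE ltW.
Qed.

End intersection_tail.

(** * Exponential moments *)

(** With the largest admissible [N] for each [r], the probability that [X] exceeds
    [A * M ^ r] decays like [theta ^ (h ^ r / p)], while [M ^ gamma = h] bounds
    [X ^ gamma] by a multiple of [h ^ (r + 1)] below the next threshold.  With
    [kappa] small this costs only [theta ^ (- N / 2)], and the sum over [r]
    converges. *)
Lemma stretched_exponential_moment d (T : measurableType d) (R : realType)
    (P : probability T R) (X : T -> \bar R) (p : nat) (theta A A' M h gamma : R) :
    (0 < p)%N -> 0 < theta -> theta < 1 -> 0 < A -> 0 <= M -> 1 < h -> 0 < gamma ->
    M `^ gamma = h -> (forall w, 0 <= X w)%E ->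
    (forall r N : nat, (p * N)%:R <= h ^+ r ->
      exists Bad : set T, [/\ measurable Bad, (P Bad <= (A' * theta ^+ N)%:E)%E &
        forall w, ~ Bad w -> (X w <= (A * M ^+ r)%:E)%E]) ->
  exists2 kappa : R, 0 < kappa &
    (\int[P]_w expeR (kappa%:E * (X w `^ gamma)) < +oo)%E.
Proof.
move=> p0 t0 t1 A0 M0 h1 g0 Mh X0 tails.
have h0 : 0 < h by exact: lt_trans h1.
have p0' : 0 < p%:R :> R by rewrite ltr0n.
pose N r := Num.truncn (h ^+ r / p%:R).
have hN r : (p * N r)%:R <= h ^+ r.
  rewrite natrM mulrC -ler_pdivlMr// /N.
  by rewrite truncn_le divr_ge0 ?exprn_ge0 ?(ltW h0) ?(ltW p0').
have Nh r : h ^+ r <= p%:R * (N r).+1%:R.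
  rewrite mulrC -ler_pdivrMr// ltW//.
  exact: truncnS_gt.
have /choice[Bad hBad] r := tails r (N r) (hN r).
pose sigma := Num.sqrt theta.
have s0 : 0 < sigma by rewrite sqrtr_gt0.
have ss : sigma * sigma = theta by rewrite -expr2 sqr_sqrtr// ltW.
have s1 : sigma < 1 by rewrite -(@expr_lt1 _ 2) ?expr2 ?ss// sqrtr_ge0.
pose lam := sigma^-1.
have lam1 : 1 < lam by rewrite invf_gt1.
have lam0 : 0 < lam by exact: lt_trans lam1.
(* [lam] is [theta ^ (- 1 / 2)], and [kappa] is such that raising [N] by one
   costs a factor [lam] in the exponential moment. *)
pose kappa := ln lam / (A `^ gamma * h * p%:R).
have Ag0 : 0 < A `^ gamma by rewrite powR_gt0.
have kappa0 : 0 < kappa by rewrite divr_gt0 ?ln_gt0// !mulr_gt0.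
have kappaE n : expR (kappa * (A `^ gamma * h * p%:R * n%:R)) = lam ^+ n.
  rewrite /kappa mulrA mulfVK ?gt_eqF ?mulr_gt0//.
  by rewrite mulrC expRM_natl lnK// posrE.
exists kappa => //.
have XA w r : ~ Bad r w ->
    (expeR (kappa%:E * (X w `^ gamma)) <= (expR (kappa * (A `^ gamma * h ^+ r)))%:E)%E.
  have [_ _ /(_ w) h3] := hBad r => /h3 Xw.
  rewrite -[leRHS]/(expeR (kappa * (A `^ gamma * h ^+ r))%:E) lee_expeR [leRHS]EFinM.
  apply: lee_wpmul2l; first by rewrite lee_fin ltW.
  have -> : (A `^ gamma * h ^+ r)%:E = ((A * M ^+ r)%:E `^ gamma)%E.
    rewrite poweR_EFin powRM ?exprn_ge0 ?(ltW A0)// -Mh.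
    congr (_ * _)%:E; rewrite -!powR_mulrn ?powR_ge0// -!powRrM.
    by rewrite mulrC.
  apply: gt0_ler_poweR; rewrite ?(ltW g0)// in_itv /= ?leey ?andbT//.
  by rewrite lee_fin mulr_ge0 ?exprn_ge0// ltW.
pose K0 := expR (kappa * (A `^ gamma)).
have Bad_ge0 r w : (0 <= (lam ^+ (N r).+1 * \1_(Bad r) w)%:E)%E.
  by rewrite lee_fin mulr_ge0// exprn_ge0// ltW.
have pointwise w : (expeR (kappa%:E * (X w `^ gamma)) <=
    K0%:E + \sum_(r <oo) (lam ^+ (N r).+1 * \1_(Bad r) w)%:E)%E.
  have sum0 : (0 <= \sum_(r <oo) (lam ^+ (N r).+1 * \1_(Bad r) w)%:E)%E.
    by apply: nneseries_ge0.
  have [allBad|/existsNP nBad] := pselect (forall r, Bad r w).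
    suff -> : (\sum_(r <oo) (lam ^+ (N r).+1 * \1_(Bad r) w)%:E = +oo)%E.
      by rewrite addey// leey.
    apply/eqyP => x x0.
    apply: (@le_trans _ _ (\sum_(0 <= r < Num.bound x)
      (lam ^+ (N r).+1 * \1_(Bad r) w)%:E)%E); last exact: nneseries_lim_ge.
    rewrite sumEFin lee_fin.
    apply: (@le_trans _ _ (\sum_(0 <= r < Num.bound x) 1)).
      rewrite big_const_nat subn0 iter_addr_0.
      by apply: ltW; exact: archi_boundP (ltW x0).
    apply: ler_sum => r _; rewrite indicE mem_set// mulr1.
    by rewrite exprn_ege1// ltW.
  have /ex_minnP[r0 /asboolP nBr0 minr0] : exists r, `[<~ Bad r w>].
    by case: nBad => r nB; exists r; exact/asboolP.
  case: r0 nBr0 minr0 => [nB _|r nB minr].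
    apply: le_trans (XA _ _ nB) _; rewrite expr0 mulr1 leeDl//.
  have Br : Bad r w.
    apply: contrapT => nBr; have := minr r (introT (asboolP _) nBr).
    by rewrite ltnn.
  apply: le_trans (XA _ _ nB) _.
  apply: (@le_trans _ _ (lam ^+ (N r).+1)%:E).
    rewrite lee_fin -kappaE ler_expR ler_wpM2l ?(ltW kappa0)//.
    rewrite -!mulrA ler_wpM2l ?(ltW Ag0)// exprS ler_wpM2l ?(ltW h0)//.
  apply: (@le_trans _ _ (\sum_(0 <= i < r.+1) (lam ^+ (N i).+1 * \1_(Bad i) w)%:E)%E).
    rewrite big_nat_recr//= indicE mem_set// mulr1 leeDr//.
    by apply: sume_ge0.
  apply: le_trans (nneseries_lim_ge _ _) _ => //.
  by rewrite leeDr// lee_fin expR_ge0.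
apply: le_lt_trans (le_integral_nneg _ _ pointwise) _; first by move=> w; exact: expeR_ge0.
have mterm r : measurable_fun setT (fun w => (lam ^+ (N r).+1 * \1_(Bad r) w)%:E).
  have [mB _ _] := hBad r.
  by apply/measurable_EFinP; apply: measurable_funM => //; exact: measurable_indic.
rewrite ge0_integralD//; last 3 first.
- by move=> w _; rewrite lee_fin expR_ge0.
- by move=> w _; exact: nneseries_ge0.
- exact: ge0_emeasurable_sum.
rewrite integral_cst// [X in (_ * X)%E]probability_setT mule1.
rewrite integral_nneseries//.
have A'0 : 0 <= A'.
  have [_ + _] := hBad 0%N; move=> /(le_trans (measure_ge0 _ _)).
  by rewrite lee_fin pmulr_lge0// exprn_gt0.
pose rho := expR ((h - 1) / p%:R * ln sigma).
have rho0 : 0 < rho by exact: expR_gt0.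
have rho1 : rho < 1.
  by rewrite expR_lt1 pmulr_rlt0 ?ln_lt0 ?s0// divr_gt0// subr_gt0.
have sN r : sigma ^+ (N r).+1 <= rho ^+ r.
  rewrite /rho -expRM_natl -[X in X ^+ _]lnK ?posrE// -expRM_natl ler_expR mulrA.
  have lns : ln sigma <= 0 by apply: ltW; rewrite ln_lt0// s0.
  rewrite ler_wnM2r//.
  rewrite mulrA ler_pdivrMr// [leRHS]mulrC; apply: le_trans (Nh r).
  have : 1 + r%:R * (h - 1) <= h ^+ r.
    elim: r => [|r IH]; first by rewrite mul0r addr0.
    rewrite exprS; apply: le_trans (ler_wpM2l (ltW h0) IH).
    have r0 : 0 <= r%:R :> R by [].
    have := mulr_ge0 r0 (sqr_ge0 (h - 1)); rewrite -natr1 expr2; lra.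
  lra.
have term_le r : (\int[P]_w (lam ^+ (N r).+1 * \1_(Bad r) w)%:E <=
    (A' * lam ^+ 2 * rho ^+ r)%:E)%E.
  have [mB PB _] := hBad r.
  under eq_integral do rewrite EFinM.
  rewrite ge0_integralZl//; last 2 first.
  - by apply/measurable_EFinP; exact: measurable_indic.
  - by rewrite lee_fin exprn_ge0// ltW.
  rewrite integral_indic// setIT.
  apply: le_trans (lee_wpmul2l _ PB) _; first by rewrite lee_fin exprn_ge0// ltW.
  rewrite -EFinM lee_fin mulrCA -mulrA ler_wpM2l//.
  apply: le_trans (ler_wpM2l _ (sN r)); last by rewrite exprn_ge0// ltW.
  rewrite le_eqVlt; apply/orP; left; apply/eqP.
  have ls n : lam ^+ n * sigma ^+ n = 1.
    by rewrite -exprMn /lam mulVf ?expr1n// gt_eqF.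
  rewrite -ss exprMn exprS -mulrA [X in lam * X]mulrA ls mul1r.
  have := ls 1%N; rewrite !expr1 => l1.
  by rewrite expr2 exprS -mulrA (mulrA lam sigma) l1 mul1r.
apply: (@le_lt_trans _ _ (K0 + A' * lam ^+ 2 * (1 - rho)^-1)%:E); last exact: ltry.
rewrite EFinD leeD2l//; apply: lime_le.
  by apply: is_cvg_nneseries => r _ _; exact: integral_ge0.
apply: nearW => n; apply: le_trans (lee_sum _ (fun i _ => term_le i)) _.
rewrite sumEFin lee_fin -mulr_sumr ler_wpM2l//.
  by rewrite mulr_ge0// exprn_ge0// ltW.
by apply: le_trans (geo_decreasing_le _ _ rho0 rho1) _; rewrite expr0 div1r.
Qed.

(** * Logarithmic distances in a metric space of polynomial growth *)

Section metric_levels.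
Context {R : realType} {V : metricType R} (d : R).
Hypothesis growthV : polynomial_growth V d.

Lemma dyadic_cover (x y : V) : exists i : nat, mdist x y <= 2 ^+ i.
Proof.
by exists (Num.bound (mdist x y)); apply: ltW; exact: upper_nthrootP.
Qed.

Definition dyadic_level (x y : V) : nat := ex_minn (dyadic_cover x y).

Lemma dyadic_level_le x y i : (dyadic_level x y <= i)%N = (mdist x y <= 2 ^+ i).
Proof.
rewrite /dyadic_level; case: ex_minnP => k hk kmin; apply/idP/idP; last exact: kmin.
by move=> ki; apply: le_trans hk _; rewrite ler_eXn2l// ltr1n.
Qed.

Lemma dyadic_level_xx x : dyadic_level x x = 0%N.
Proof. by apply/eqP; rewrite -leqn0 dyadic_level_le mdistxx. Qed.

Lemma dyadic_level_sym x y : dyadic_level x y = dyadic_level y x.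
Proof.
have le_sym u v : (dyadic_level u v <= dyadic_level v u)%N.
  by rewrite dyadic_level_le metric_sym -dyadic_level_le.
by apply/eqP; rewrite eqn_leq !le_sym.
Qed.

Lemma dyadic_level_quasi x y z : (dyadic_level x y <= (maxn (dyadic_level x z) (dyadic_level z y)).+1)%N.
Proof.
rewrite dyadic_level_le exprS mulr_natl mulr2n.
apply: le_trans (metric_triangle _ z _) _.
by apply: lerD; rewrite -dyadic_level_le ?leq_maxl ?leq_maxr.
Qed.

Lemma mball_volume : exists2 c : R, 0 <= c & forall (x : V) i,
  finite_set (mball x (2 ^+ i)) /\
  (size (finmap.enum_fset (fset_set (mball x (2 ^+ i)))))%:R <= c * (2 `^ d) ^+ i.
Proof.
case: growthV => c1 [c2 [_ c20 hc]]; exists c2; first exact: ltW.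
move=> x i; have h1 : 1 <= 2 ^+ i :> R by rewrite exprn_ege1// ler1n.
have [_] := hc x _ h1; rewrite /counting.
have -> : (2 ^+ i) `^ d = (2 `^ d) ^+ i.
  by rewrite -!powR_mulrn ?powR_ge0// -!powRrM mulrC.
case: asboolP => [fin|_]; first by rewrite lee_fin.
by rewrite leNgt ltry.
Qed.

Lemma metric_dyadic_space : exists2 S : dyadic_space R V,
  growth S = 2 `^ d & level S = dyadic_level.
Proof.
have [c c0 hc] := mball_volume.
have bu (x : V) i : uniq (finmap.enum_fset (fset_set (mball x (2 ^+ i)))).
  exact: finmap.fset_uniq.
have bm (x : V) i (y : V) : (y \in finmap.enum_fset (fset_set (mball x (2 ^+ i)))) = (dyadic_level x y <= i)%N.
  have [fin _] := hc x i; apply: (etrans (in_fset_set fin y)).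
  by rewrite dyadic_level_le; apply/idP/idP => [/set_mem//|/mem_set].
have D0 : 0 < 2 `^ d :> R by rewrite powR_gt0.
by exists (DyadicSpace dyadic_level_xx dyadic_level_sym dyadic_level_quasi bu bm D0 c0 (fun x i => (hc x i).2)).
Qed.

(** Above level zero the distance exceeds [2 ^ (level - 1)], whence the factor
    [2 ^ s]. *)
Lemma gker_le (s : R) (x y : V) : 0 <= s ->
  gker s x y <= 2 `^ s * (2 `^ (- s)) ^+ dyadic_level x y.
Proof.
move=> s0; rewrite /gker; have p0 : 0 <= mdist x y `^ s by exact: powR_ge0.
case ml : (dyadic_level x y) => [|i].
  rewrite expr0 mulr1; apply: (@le_trans _ _ 1); last first.
    by rewrite -[leLHS](powRr0 2) ler_powR// ler1n.
  by rewrite invf_le1 ?ltr_wpDr// lerDl.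
have di : 2 ^+ i < mdist x y by rewrite ltNge -dyadic_level_le ml ltnn.
rewrite exprS mulrA -powRD; last by rewrite pnatr_eq0 implybT.
rewrite subrr powRr0 mul1r powRN exprVn lef_pV2 ?posrE ?exprn_gt0 ?powR_gt0// ?ltr_wpDr//.
apply: le_trans (_ : mdist x y `^ s <= _); last by rewrite lerDr.
have -> : (2 `^ s) ^+ i = (2 ^+ i) `^ s :> R.
  by rewrite -!powR_mulrn ?powR_ge0// -!powRrM mulrC.
by apply: ge0_ler_powR; rewrite ?nnegrE ?exprn_ge0 ?mdist_ge0 ?(ltW di).
Qed.

End metric_levels.

Unset Implicit Arguments.
Set Strict Implicit.
Set Printing Implicit Defensive.

(** * Intersections of clusters *)

Theorem theorem1p7 (R : realType) (V : metricType R)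
    (countV : countable [set: V]) (o : V)
    (d : R) (d_ge1 : 1 <= d) (growthV : polynomial_growth V d)
    (disp : measure_display) (Omega : measurableType disp)
    (P : probability Omega R) (G1 G2 : {RV P >-> sgraph V})
    (indepG : independent_graphs G1 G2)
    (BK1 : BK_inequality G1) (BK2 : BK_inequality G2)
    (alpha beta : R)
    (alpha_itv : d / 2 < alpha < d) (beta_itv : d / 2 < beta < d)
    (alpha_le_beta : alpha <= beta)
    (alpha_beta : 3 * d < 2 * alpha + 2 * beta)
    (connG : exists2 C : R, 0 < C & forall x y : V,
      (P [set w | connected_in (G1 w) x y] <= (C * gker alpha x y)%:E)%E /\
      (P [set w | connected_in (G2 w) x y] <= (C * gker beta x y)%:E)%E) :
  let gamma := (2 * alpha - d) / (d + 2 * alpha - 2 * beta) in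
  exists2 kappa : R, 0 < kappa &
    (\int[P]_w expeR (kappa%:E *
        (counting (graph_cluster (G1 w) o `&` graph_cluster (G2 w) o) `^ gamma)) < +oo)%E.
Proof.
move=> gamma; case: connG => C C0 conn.
case/andP: alpha_itv => da ad; case/andP: beta_itv => db bd.
have [S SD Sm] := metric_dyadic_space growthV.
have pow2D (x y : R) : 2 `^ x * 2 `^ y = 2 `^ (x + y).
  by rewrite powRD// pnatr_eq0 implybT.
have pow2_gt1 (x : R) : 0 < x -> 1 < 2 `^ x.
  move=> x0; have : 1 `^ x < 2 `^ x :> R.
    by apply: gt0_ltr_powR; rewrite ?nnegrE ?ler0n ?ltr1n.
  by rewrite powR1.
have pow2_lt1 (x : R) : x < 0 -> 2 `^ x < 1.
  move=> x0; rewrite -(opprK x) powRN invf_lt1 ?powR_gt0//.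
  by apply: pow2_gt1; rewrite oppr_gt0.
have mid (s : R) : d / 2 < s -> s < d -> intermediate_ratio S (2 `^ (- s)).
  move=> h1 h2; split; rewrite ?SD ?expr2 ?pow2D ?powR_gt0//.
  - by apply: pow2_lt1; lra.
  - by apply: pow2_gt1; lra.
  - by apply: pow2_lt1; lra.
have qq2D : (2 `^ (- alpha)) ^+ 2 * growth S * ((2 `^ (- beta)) ^+ 2 * growth S) * growth S < 1.
  by rewrite SD !expr2 !pow2D; apply: pow2_lt1; lra.
(* One constant for both graphs: [2 ^ alpha <= 2 ^ beta]. *)
pose C' := C * 2 `^ beta.
have C'0 : 0 <= C' by rewrite mulr_ge0 ?powR_ge0// ltW.
have gC (s : R) x y : d / 2 < s -> s <= beta ->
    C * gker s x y <= C' * (2 `^ (- s)) ^+ level S x y.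
  move=> h1 h2; rewrite /C' -mulrA ler_wpM2l ?(ltW C0)//.
  have s0 : 0 <= s by lra.
  apply: le_trans (gker_le x y s0) _.
  rewrite Sm ler_wpM2r ?exprn_ge0 ?powR_ge0//.
  by rewrite ler_powR// ler1n.
have conn1 x y : (P [set w | connected_in (G1 w) x y] <=
    (C' * (2 `^ (- alpha)) ^+ level S x y)%:E)%E.
  by apply: le_trans (conn x y).1 _; rewrite lee_fin gC.
have conn2 x y : (P [set w | connected_in (G2 w) x y] <=
    (C' * (2 `^ (- beta)) ^+ level S x y)%:E)%E.
  by apply: le_trans (conn x y).2 _; rewrite lee_fin gC.
have [p [theta [A [A' [[p0 t0 t1 A0] tails]]]]] := intersection_tail countV indepG
  BK1 BK2 o (mid _ da ad) (mid _ db bd) qq2D C'0 conn1 conn2.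
have hE : ((2 `^ (- alpha)) ^+ 2 * growth S)^-1 = 2 `^ (2 * alpha - d) :> R.
  by rewrite SD expr2 !pow2D -powRN; congr (_ `^ _); lra.
have ME : (2 `^ (- beta)) ^+ 2 * growth S * growth S /
    ((2 `^ (- alpha)) ^+ 2 * growth S) = 2 `^ (d + 2 * alpha - 2 * beta) :> R.
  by rewrite hE SD expr2 !pow2D; congr (_ `^ _); lra.
rewrite ME hE in tails.
apply: (stretched_exponential_moment p0 t0 t1 A0 _ _ _ _ _ tails).
- exact: powR_ge0.
- by apply: pow2_gt1; lra.
- by rewrite divr_gt0//; lra.
- rewrite -powRrM /gamma mulrC divfK// gt_eqF//; lra.
- by move=> w; rewrite /counting; case: ifP.
Qed.
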